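(* Let $F$ be a strongly convex norm on $\mathbb{R}^n$ (in the sense of the context), let $\Omega\subset\mathbb{R}^n$ be a domain with non-empty boundary, and let $d_F$ be the anisotropic distance function to $\partial\Omega$. Suppose that $d_F$ is $\Delta_F$-superharmonic in $\Omega$. Then for every $u\in H_0^1(\Omega)$, $$\int_{\Omega} F(\nabla u)^2\,dx \;\ge\; \frac14\int_{\Omega}\frac{u^2}{d_F^2}\,dx .$$
   Context: Standing assumptions on $F$: $F:\mathbb{R}^n\to[0,+\infty)$ is convex, satisfies $F(t\xi)=|t|F(\xi)$ for all $t\in\mathbb{R}$, $\xi\in\mathbb{R}^n$, and $\alpha_1|\xi|\le F(\xi)$ for all $\xi$ for some constant $\alpha_1>0$; moreover $F\in C^2(\mathbb{R}^n\setminus\{0\})$ and the Hessian $\nabla^2_\xi F^2$ is positive definite on $\mathbb{R}^n\setminus\{0\}$. $F_\xi$ denotes the gradient of $F$. Polar function: $F^o(x)=\sup_{\xi\ne0}\frac{\xi\cdot x}{F(\xi)}$. A domain is a connected open set. For a domain $\Omega$ with non-empty boundary, the anisotropic distance to the boundary is $d_F(x)=\inf_{y\in\partial\Omega}F^o(x-y)$, $x\in\overline\Omega$. It is Lipschitz and satisfies $F(\nabla d_F)=1$ a.e. in $\Omega$. Finsler Laplacian: $\Delta_F u=\operatorname{div}(F(\nabla u)F_\xi(\nabla u))$. The function $d_F$ is $\Delta_F$-superharmonic in $\Omega$ if $-\Delta_F d_F\ge0$ in the sense of distributions, i.e. $\int_\Omega F(\nabla d_F)F_\xi(\nabla d_F)\cdot\nabla\varphi\,dx\ge0$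 for all $\varphi\in C_0^\infty(\Omega)$ with $\varphi\ge0$. *)

(* Defs.v *)
From HB Require Import structures.
From mathcomp Require Import all_boot all_order all_algebra.
From mathcomp Require Import all_classical all_reals all_analysis.
Set Implicit Arguments.
Unset Strict Implicit.
Unset Printing Implicit Defensive.
Import Order.TTheory GRing.Theory Num.Theory.
Import numFieldNormedType.Exports.
Local Open Scope classical_set_scope.
Local Open Scope ring_scope.

(* 'rV[R]_n is given the product sigma-algebra of its coordinates (as the
   library does for n.-tuple), which is the Borel sigma-algebra of R^n. *)
Section row_measurable.
Context (R : realType) (n : nat).

Let coor (i : 'I_n) (v : 'rV[R]_n) : measurableTypeR R := v ord0 i.

Let row_set0 : g_sigma_preimage coor set0.
Proof. exact: sigma_algebra0. Qed.

Let row_setC A : g_sigma_preimage coor A -> g_sigma_preimage coor (~` A).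
Proof. exact: sigma_algebraC. Qed.

Let row_bigcup (A : (set 'rV[R]_n)^nat) :
  (forall i, g_sigma_preimage coor (A i)) ->
  g_sigma_preimage coor (\bigcup_i A i).
Proof. exact: sigma_algebra_bigcup. Qed.

HB.instance Definition _ :=
  @isMeasurable.Build default_measure_display 'rV[R]_n
    (g_sigma_preimage coor) row_set0 row_setC row_bigcup.

Lemma measurable_fun_rowP d (T : measurableType d) (f : T -> 'rV[R]_n) :
  measurable_fun setT f <->
  forall i, measurable_fun setT (fun x => f x ord0 i : measurableTypeR R).
Proof.
apply: (@iff_trans _ (g_sigma_preimage
    (fun i => coor i \o f) `<=` measurable)).
  rewrite g_sigma_preimage_comp; split=> [mf A [/= C preC <-]|prefS].
    exact: mf.
  by move=> _ A mA; apply: prefS; exists A.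
split=> [coorS i|mf].
- move=> _ A mA; apply: coorS; apply: sub_sigma_algebra => /=.
  rewrite -bigcup_seq/=; exists i => /=; first by rewrite mem_index_enum.
  by exists A.
- apply: smallest_sub; first exact: sigma_algebra_measurable.
  rewrite -bigcup_seq/=; apply: bigcup_sub => i _.
  by move=> A [B mB <-]; exact: mf.
Qed.

Lemma measurable_coor (i : 'I_n) :
  measurable_fun setT (fun v : 'rV[R]_n => v ord0 i : measurableTypeR R).
Proof. exact: (measurable_fun_rowP id).1. Qed.

End row_measurable.

Section lebesgue_row.
Context {R : realType}.

Definition row_cons n (p : measurableTypeR R * 'rV[R]_n) : 'rV[R]_n.+1 :=
  row_mx (const_mx p.1 : 'rV_1) p.2.

Definition row_uncons n (v : 'rV[R]_n.+1) : measurableTypeR R * 'rV[R]_n :=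
  (v ord0 ord0, @rsubmx R 1 1 n v).

Lemma row_consK n : cancel (@row_cons n) (@row_uncons n).
Proof.
move=> [x v]; rewrite /row_cons /row_uncons /= row_mxKr; congr pair.
rewrite -[LHS]/(@fun_of_matrix R 1 (1 + n) _ _ _).
rewrite (_ : ord0 = lshift n ord0 :> 'I_(1 + n)); last exact: val_inj.
by rewrite row_mxEl mxE.
Qed.

Lemma measurable_row_cons n : measurable_fun setT (@row_cons n).
Proof.
apply/measurable_fun_rowP => i; rewrite /row_cons.
case: (@split_ordP 1 n i) => j ->.
  rewrite (_ : (fun _ => _) = fst) //; apply/funext => p.
  by rewrite [LHS](row_mxEl _ _ ord0 j) mxE.
rewrite (_ : (fun _ => _) =
  fun p : measurableTypeR R * 'rV[R]_n => p.2 ord0 j : measurableTypeR R).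
  exact: (measurableT_comp (measurable_coor j)).
by apply/funext => p; rewrite [LHS](row_mxEr _ _ ord0 j).
Qed.

Lemma measurable_row_uncons n : measurable_fun setT (@row_uncons n).
Proof.
apply: measurable_fun_pair => /=; first exact: measurable_coor.
apply/measurable_fun_rowP => i; under eq_fun do rewrite mxE.
exact: measurable_coor.
Qed.

Section lebesgue_row_succ.
Context (n : nat) (m : {sigma_finite_measure set 'rV[R]_n -> \bar R}).
Local Open Scope ereal_scope.

Definition lebesgue_row_succ : set 'rV[R]_n.+1 -> \bar R :=
  pushforward (lebesgue_measure \x m) (@row_cons n).

Let m' := lebesgue_row_succ.

Let m'0 : m' set0 = 0.
Proof. by rewrite /m' /lebesgue_row_succ /pushforward preimage_set0 measure0. Qed.

Let m'_ge0 A : 0 <= m' A.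
Proof. exact: (measure_ge0 (lebesgue_measure \x m)). Qed.

Let m'_sigma_additive : semi_sigma_additive m'.
Proof.
move=> A mA tA mUA; rewrite /m' /lebesgue_row_succ /pushforward preimage_bigcup.
apply: (@measure_semi_sigma_additive _ _ _ (lebesgue_measure \x m)).
- by move=> i; rewrite -[X in measurable X]setTI; exact: measurable_row_cons.
- apply/trivIsetP => /= i j _ _ ij; rewrite -preimage_setI.
  by move/trivIsetP : tA => /(_ _ _ _ _ ij) ->//; rewrite preimage_set0.
- by rewrite -preimage_bigcup -[X in measurable X]setTI;
    exact: measurable_row_cons.
Qed.

HB.instance Definition _ :=
  isMeasure.Build _ _ _ m' m'0 m'_ge0 m'_sigma_additive.

Let m'_sigma_finite : sigma_finite setT m'.
Proof.
have [A UA mA] : sigma_finite setT (lebesgue_measure \x m).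
  have /sigma_finiteP[A [TA ndA Aoo]] := sigma_finiteT (@lebesgue_measure R).
  have /sigma_finiteP[B [TB ndB Boo]] := sigma_finiteT m.
  exists (fun i => A i `*` B i).
    rewrite -setXTT TA TB predeqE => -[x y]; split.
      move=> [/= [i _ Aix] [j _ Bjy]]; exists (maxn i j) => //; split.
      - by move: x Aix; exact/subsetPset/ndA/leq_maxl.
      - by move: y Bjy; exact/subsetPset/ndB/leq_maxr.
    by move=> [i _ []/= ? ?]; split; exists i.
  move=> i; have [? ?] := Aoo i; have [? ?] := Boo i.
  split; first exact: measurableX.
  by rewrite product_measure1E// lte_mul_pinfty// ge0_fin_numE.
exists (fun i => @row_uncons n @^-1` A i).
  by rewrite -preimage_bigcup -UA preimage_setT.
move=> i; have [mAi Aioo] := mA i; split.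
  by rewrite -[X in measurable X]setTI; exact: measurable_row_uncons.
rewrite /m' /lebesgue_row_succ /pushforward -comp_preimage.
rewrite (_ : _ \o _ = id) ?preimage_id//.
by apply/funext => p /=; rewrite row_consK.
Qed.

HB.instance Definition _ :=
  Measure_isSigmaFinite.Build _ _ _ m' m'_sigma_finite.

End lebesgue_row_succ.

Fixpoint lebesgue_row n : {sigma_finite_measure set 'rV[R]_n -> \bar R} :=
  match n with
  | 0 => \d_(0 : 'rV[R]_0)
  | n'.+1 => lebesgue_row_succ (lebesgue_row n')
  end.

End lebesgue_row.

Section calculus.
Context {R : realType} {n : nat}.
Implicit Types (f : 'rV[R]_n -> R) (x v w : 'rV[R]_n) (U : set 'rV[R]_n).

Definition dotp v w : R := \sum_i v ord0 i * w ord0 i.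

(* The norm `|v| of the library on 'rV[R]_n is the sup norm. *)
Definition euclidean_norm v : R := Num.sqrt (dotp v v).

Definition partial (i : 'I_n) f : 'rV[R]_n -> R :=
  fun x => 'D_(delta_mx ord0 i) f x.

Definition gradient f x : 'rV[R]_n := \row_i partial i f x.

Definition hessian f x : 'M[R]_n := \matrix_(i, j) partial i (partial j f) x.

Definition posdefmx (A : 'M[R]_n) : Prop :=
  forall v, v != 0 -> 0 < dotp (v *m A) v.

Fixpoint Ck (k : nat) U f : Prop :=
  (forall x, U x -> {for x, continuous f}) /\
  match k with
  | 0 => True
  | k'.+1 => forall i,
      (forall x, U x -> derivable f x (delta_mx ord0 i)) /\
      Ck k' U (partial i f)
  end.

Definition smooth f : Prop := forall k, Ck k setT f.

(* C_c^oo(U), its elements being extended by 0 outside of U. *)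
Definition test_function U f : Prop :=
  [/\ smooth f, compact (closure [set x | f x != 0]) &
      closure [set x | f x != 0] `<=` U].

Definition domain U : Prop := open U /\ connected U.

Definition boundary U : set 'rV[R]_n := closure U `\` interior U.

End calculus.

Section sobolev.
Context {R : realType} {n : nat}.
Implicit Types (Omega : set 'rV[R]_n) (u : 'rV[R]_n -> R)
  (Du : 'rV[R]_n -> 'rV[R]_n).
Local Notation mu := (@lebesgue_row R n).

Definition L2 Omega u : Prop :=
  measurable_fun Omega u /\ (\int[mu]_(x in Omega) (u x ^+ 2)%:E < +oo)%E.

Definition weak_gradient Omega u Du : Prop :=
  forall (i : 'I_n) phi, test_function Omega phi ->
    \int[mu]_(x in Omega) (u x * partial i phi x) =
    - \int[mu]_(x in Omega) (Du x ord0 i * phi x).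

(* u belongs to H^1(Omega), with weak gradient Du. *)
Definition H1 Omega u Du : Prop :=
  [/\ L2 Omega u, forall i, L2 Omega (fun x => Du x ord0 i) &
      weak_gradient Omega u Du].

(* u belongs to the closure of C_c^oo(Omega) in H^1(Omega), with weak
   gradient Du. *)
Definition H10 Omega u Du : Prop :=
  H1 Omega u Du /\
  forall e : R, 0 < e -> exists2 phi, test_function Omega phi &
    (\int[mu]_(x in Omega) ((u x - phi x) ^+ 2)%:E +
     \int[mu]_(x in Omega) (euclidean_norm (Du x - gradient phi x) ^+ 2)%:E
       < e%:E)%E.

End sobolev.

Section finsler.
Context {R : realType} {n : nat}.
Implicit Types (F : 'rV[R]_n -> R) (Omega : set 'rV[R]_n).

Record strongly_convex_norm F : Prop := {
  scn_ge0 : forall xi, 0 <= F xi;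
  scn_convex : @convex_function R 'rV[R]_n setT F;
  scn_homogeneous : forall (t : R) xi, F (t *: xi) = `|t| * F xi;
  scn_coercive : exists2 alpha : R, 0 < alpha &
    forall xi, alpha * euclidean_norm xi <= F xi;
  scn_C2 : Ck 2 [set xi | xi != 0] F;
  scn_hessian : forall xi, xi != 0 ->
    posdefmx (hessian (fun eta => F eta ^+ 2) xi)
}.

Definition polar F (x : 'rV[R]_n) : R :=
  sup [set dotp xi x / F xi | xi in [set xi | xi != 0]].

Definition dist_boundary F Omega (x : 'rV[R]_n) : R :=
  inf [set polar F (x - y) | y in boundary Omega].

(* The gradient of u is the pointwise one, to be used for functions u that are
   differentiable almost everywhere, such as Lipschitz functions. Where it
   vanishes, the integrand vanishes too. *)
Definition finsler_superharmonic F Omega (u : 'rV[R]_n -> R) : Prop :=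
  forall phi, test_function Omega phi -> (forall x, 0 <= phi x) ->
    0 <= \int[@lebesgue_row R n]_(x in Omega)
      (F (gradient u x) * dotp (gradient F (gradient u x)) (gradient phi x)).

End finsler.

(* Main.v *)
Require Import Defs.
From HB Require Import structures.
From mathcomp Require Import all_boot all_order all_algebra.
From mathcomp Require Import all_classical all_reals all_analysis.
From mathcomp Require Import measurable_realfun ring lra.
Import Order.TTheory GRing.Theory Num.Theory.
Import numFieldNormedType.Exports.
Local Open Scope classical_set_scope.
Local Open Scope ring_scope.

(** The classical argument tests the superharmonicity of the distance [d] with
    u^2 / d. As F(grad d) = 1 almost everywhere, and as grad F(p).v <= F v for
    every nonzero p, this gives
      integral of u^2 / d^2 <= integral of 2 |u| / d * F(grad u),
    and Young's (or the Cauchy-Schwarz) inequality concludes.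

    The test function u^2 / d is only Lipschitz and [u] is only weakly
    differentiable, so three approximations are made. First [u] is a test
    function [phi], [d] is replaced by d + delta with delta > 0, and the distance
    in the denominator is mollified, with the square of [phi] as a kernel
    ([mollify]). The gradients of the mollified distances are bounded and converge
    to the gradient of [d] wherever [d] is differentiable along all directions
    with a linear derivative ([partial_mollify_le], [partial_mollify_cvg]), so
    dominated convergence gives the inequality for [phi] and d + delta
    ([hardy_test]). Then the weight is bounded and the density of the test
    functions gives the inequality for [u] ([hardy_shifted]). Finally delta tends
    to 0 by monotone convergence ([hardy_H10]).

    What has to be known about [d] is that it is differentiable almost everywhere
    with F(grad d) = 1. The upper bound on F(grad d) expresses that [d] is
    1-Lipschitz for the polar norm, and the lower bound comes from moving towards
    a nearest boundary point. For the differentiability, the positive Hessian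
    makes the squared norm strongly convex ([finsler_strongly_convex]), so by
    duality the squared polar norm is semiconcave ([polar_sqr_semiconcave]), and
    so is d^2, an infimum of its translates ([dist_sqr_semiconcave]). Hence a
    quadratic polynomial minus d^2 is a convex function. Its second difference
    quotients are nonnegative, and they tend to 0 in the mean, because the
    differences can be moved onto a smooth weight by translation invariance of the
    Lebesgue measure. So it has partial derivatives almost everywhere
    ([convex_ae_derivable]), and for a convex function these yield all the
    directional derivatives ([convex_is_derive]). *)

Set Implicit Arguments.
Unset Strict Implicit.
Unset Printing Implicit Defensive.

(** * Directional derivatives *)

Section directional.
Context {R : realType} {n : nat}.
Implicit Types (f : 'rV[R]_n -> R) (x v w : 'rV[R]_n).

(** Without division by the increment the case of a zero increment needs no
    separate treatment. *)
Lemma is_derive_epsP f x v d :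
  is_derive x v f d <->
  forall e : R, 0 < e -> exists2 r : R, 0 < r & forall h : R, `|h| < r ->
    `|f (x + h *: v) - f x - h * d| <= e * `|h|.
Proof.
have key h : h != 0 ->
    `|f (x + h *: v) - f x - h * d| =
    `|d - h^-1 *: ((f \o shift x) (h *: v) - f x)| * `|h|.
  move=> h0; rewrite -normrM /= (addrC _ x); set y := _ - f x.
  rewrite -[X in d - X]/(h^-1 * y) mulrBl.
  by rewrite mulrAC mulVf// mul1r distrC mulrC.
split=> [[fd fde] e e0|H].
  move: fd => /cvgrPdist_le/(_ e e0) [r/= r0 rP].
  exists r => // h hr; have [->|h0] := eqVneq h 0.
    by rewrite scale0r addr0 mul0r !subrr normr0 mulr0.
  have := rP h; rewrite /ball_/= sub0r normrN => /(_ hr h0) {}rP.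
  by rewrite key// ler_wpM2r// -fde.
suff fd : (fun h => h^-1 *: ((f \o shift x) (h *: v) - f x)) @ 0^' --> d.
  by apply: DeriveDef; [apply/cvg_ex; exists d|exact/cvg_lim].
apply/cvgrPdist_le => e /H [r r0 rP]; exists r => //= h.
rewrite /ball_/= sub0r normrN => hr h0.
by have := rP h hr; rewrite key// ler_pM2r ?normr_gt0.
Qed.

(** Transfers the one-variable theory to directional derivatives. *)
Lemma is_derive_line f x v (s d : R) :
  is_derive (x + s *: v) v f d <-> is_derive s 1 (fun t => f (x + t *: v)) d.
Proof.
have E : (fun h : R => h^-1 *: ((f \o shift (x + s *: v)) (h *: v) - f (x + s *: v)))
   = (fun h : R => h^-1 *: (((fun t => f (x + t *: v)) \o shift s) (h *: 1)
        - f (x + s *: v))).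
  apply/funext => h /=; congr (_ *: (f _ - _)).
  by rewrite [_ *: 1]mulr1 scalerDl addrCA.
by split=> -[fd fde]; apply: DeriveDef;
  rewrite /derivable /derive ?E -?E// -?fde /derive ?E.
Qed.

Lemma is_deriveZv f x v (k d : R) :
  is_derive x v f d -> is_derive x (k *: v) f (k * d).
Proof.
move=> /is_derive_epsP H; apply/is_derive_epsP => e e0.
have k1 : 0 < `|k| + 1 by rewrite ltr_wpDl.
have [|r r0 rP] := H (e / (`|k| + 1)); first by rewrite divr_gt0.
exists (r / (`|k| + 1)) => [|h hr]; first by rewrite divr_gt0.
rewrite scalerA mulrA.
have hk : `|h * k| <= `|h| * (`|k| + 1) by rewrite normrM ler_wpM2l// lerDl.
apply: le_trans (rP _ _) _.
  by apply: le_lt_trans hk _; rewrite -ltr_pdivlMr.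
rewrite -mulrA ler_pM2l//.
by rewrite ler_pdivrMl// [leRHS]mulrC.
Qed.

Lemma mvt_segment f x v :
  (forall s : R, 0 <= s <= 1 -> derivable f (x + s *: v) v) ->
  exists2 s : R, 0 <= s <= 1 & f (x + v) - f x = 'D_v f (x + s *: v).
Proof.
move=> df.
have D (s : R) : 0 <= s <= 1 ->
    is_derive s 1 (fun t : R => f (x + t *: v)) ('D_v f (x + s *: v)).
  by move=> s01; apply/is_derive_line; apply: DeriveDef => //; exact: df.
have [||s s01] := @MVT _ (fun t : R => f (x + t *: v))
  (fun s : R => 'D_v f (x + s *: v)) 0 1 ltr01.
- by move=> s; rewrite in_itv/= => /andP[s0 s1]; apply: D; rewrite !ltW.
- apply: derivable_within_continuous => s; rewrite in_itv/= => s01.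
  by have [] := D s s01.
rewrite scale1r scale0r addr0 subr0 mulr1 => E.
by exists s => //; move: s01; rewrite in_itv/= => /andP[s0 s1]; rewrite !ltW.
Qed.

Lemma dotpC v w : dotp v w = dotp w v.
Proof. by apply: eq_bigr => i _; rewrite mulrC. Qed.

Lemma dotpDl v v' w : dotp (v + v') w = dotp v w + dotp v' w.
Proof. by rewrite /dotp -big_split; apply: eq_bigr => i _; rewrite mxE mulrDl. Qed.

Lemma dotpZl (k : R) v w : dotp (k *: v) w = k * dotp v w.
Proof. by rewrite /dotp mulr_sumr; apply: eq_bigr => i _; rewrite mxE mulrA. Qed.

Lemma dotpDr v v' w : dotp w (v + v') = dotp w v + dotp w v'.
Proof. by rewrite dotpC dotpDl !(dotpC w). Qed.

Lemma dotpZr (k : R) v w : dotp w (k *: v) = k * dotp w v.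
Proof. by rewrite dotpC dotpZl (dotpC w). Qed.

Lemma dotpNl v w : dotp (- v) w = - dotp v w.
Proof. by rewrite -scaleN1r dotpZl mulN1r. Qed.

Lemma dotpNr v w : dotp w (- v) = - dotp w v.
Proof. by rewrite -scaleN1r dotpZr mulN1r. Qed.

Lemma dotp0r w : dotp w 0 = 0.
Proof. by rewrite /dotp big1// => i _; rewrite mxE mulr0. Qed.

Lemma dotp_ge0 v : 0 <= dotp v v.
Proof. by apply: sumr_ge0 => i _; rewrite -expr2 sqr_ge0. Qed.

Lemma coord_le_norm v i : `|v ord0 i| <= `|v|.
Proof.
rewrite [leRHS]/Num.norm /= mx_normrE; apply/bigmax_geP; right => /=.
by exists (ord0, i).
Qed.

Lemma norm_le_coord v (c : R) :
  0 <= c -> (forall i, `|v ord0 i| <= c) -> `|v| <= c.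
Proof.
move=> c0 vc; rewrite [leLHS]/Num.norm /= mx_normrE; apply/bigmax_leP; split => //.
by move=> [i j] _ /=; rewrite (ord1 i).
Qed.

Lemma dotp_le_norm v w : `|dotp v w| <= n%:R * (`|v| * `|w|).
Proof.
apply: (le_trans (ler_norm_sum _ _ _)).
rewrite -[n in n%:R]card_ord -sumr_const mulr_suml; apply: ler_sum => i _.
by rewrite mul1r normrM ler_pM ?coord_le_norm.
Qed.

Lemma norm_le_euclidean v : `|v| <= euclidean_norm v.
Proof.
apply: norm_le_coord => [|i]; first exact: sqrtr_ge0.
rewrite -sqrtr_sqr ler_wsqrtr// /dotp (bigD1 i)//= -expr2 lerDl.
by apply: sumr_ge0 => j _; rewrite -expr2 sqr_ge0.
Qed.

Lemma sqr_norm_le_dotp v : `|v| ^+ 2 <= dotp v v.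
Proof.
rewrite -[leRHS]sqr_sqrtr ?dotp_ge0//.
by rewrite ler_pXn2r ?nnegrE ?sqrtr_ge0//; exact: norm_le_euclidean.
Qed.

Lemma dotp_gradient f x v :
  dotp (gradient f x) v = \sum_i v ord0 i * partial i f x.
Proof. by apply: eq_bigr => i _; rewrite mxE mulrC. Qed.

Lemma dotp_delta v i : dotp v (delta_mx ord0 i) = v ord0 i.
Proof.
rewrite /dotp (bigD1 i)//= big1 => [|j ji]; rewrite !mxE eqxx /=.
  by rewrite eqxx mulr1 addr0.
by rewrite (negPf ji) mulr0.
Qed.

Lemma gradient_unique f x p :
  (forall v, is_derive x v f (dotp p v)) -> gradient f x = p.
Proof.
move=> D; apply/rowP => i; rewrite mxE /partial.
by have [_ ->] := D (delta_mx ord0 i); rewrite dotp_delta.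
Qed.

Lemma is_derive_dotp_sqr x v : is_derive x v (fun y => dotp y y) (2 * dotp x v).
Proof.
apply/is_derive_epsP => e e0.
have c0 : 0 < dotp v v + 1 by rewrite ltr_wpDl// dotp_ge0.
exists (e / (dotp v v + 1)) => [|h hr]; first by rewrite divr_gt0.
rewrite !(dotpDl, dotpDr, dotpZl, dotpZr) (dotpC v x).
rewrite (_ : _ - _ - _ = h * h * dotp v v); last by ring.
rewrite !normrM (ger0_norm (dotp_ge0 v)) mulrAC ler_wpM2r//.
move: hr; rewrite ltr_pdivlMr// => /ltW; apply: le_trans.
by rewrite ler_wpM2l// lerDl.
Qed.

Lemma is_derive_sqrt_fun (g : 'rV[R]_n -> R) x v (a : R) : 0 < g x ->
  is_derive x v g a ->
  is_derive x v (fun y => Num.sqrt (g y)) ((2 * Num.sqrt (g x))^-1 * a).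
Proof.
move=> gx0 Dg.
have D0 : is_derive (0 : R) 1 (fun t => g (x + t *: v)) a.
  by apply/is_derive_line; rewrite scale0r addr0.
have g0 : 0 < g (x + 0 *: v) by rewrite scale0r addr0.
have D : is_derive (0 : R) 1 (Num.sqrt \o (fun t => g (x + t *: v)))
    ((2 * Num.sqrt (g (x + 0 *: v)))^-1 * a).
  exact: (is_derive1_comp (is_derive1_sqrt g0) D0).
move: D; rewrite scale0r addr0 => D.
have := (@is_derive_line (fun y => Num.sqrt (g y)) x v 0 _).2 D.
by rewrite scale0r addr0.
Qed.

Lemma is_derive_le (f : 'rV[R]_n -> R) x v (d c : R) : is_derive x v f d ->
  (forall s : R, 0 < s <= 1 -> f (x + s *: v) - f x <= s * c) -> d <= c.
Proof.
move=> /is_derive_epsP D H; apply/ler_addgt0Pr => e e0.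
have [r r0 rP] := D e e0.
pose s := Num.min (r / 2) 1.
have s0 : 0 < s by rewrite lt_min ltr01 divr_gt0.
have s1 : s <= 1 by rewrite ge_min lexx orbT.
have sr : s < r by rewrite /s gt_min; apply/orP; left; lra.
have := rP s; rewrite gtr0_norm// => /(_ sr); rewrite ler_norml => /andP[+ _].
have := H s; rewrite s0 s1 => /(_ isT).
move=> H1 H2; suff: s * d <= s * (c + e) by rewrite ler_pM2l.
by rewrite mulrDr [s * e]mulrC; lra.
Qed.

End directional.

(** * From partial to directional derivatives *)

Section gateaux.
Context {R : realType} {n : nat}.
Implicit Types (f : 'rV[R]_n -> R) (x v w : 'rV[R]_n).

Lemma norm_delta_mx_le1 i : `|delta_mx ord0 i : 'rV[R]_n| <= 1.
Proof.
apply: norm_le_coord => // j; rewrite mxE eqxx/=.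
by case: eqP => _; rewrite ?normr1 ?normr0.
Qed.

Lemma derivable_partial f x i :
  derivable f x (delta_mx ord0 i) ->
  is_derive x (delta_mx ord0 i) f (partial i f x).
Proof. exact: derivableP. Qed.

(** One step of the passage from partial derivatives to directional ones: after a
    displacement along [w], the further displacement along a coordinate axis is
    estimated by the mean value theorem and the continuity of that partial
    derivative at [x]. *)
Lemma is_derive_add_coord f x w i (a c : R) :
  is_derive x w f a ->
  (\forall y \near x, derivable f y (delta_mx ord0 i)) ->
  {for x, continuous (partial i f)} ->
  is_derive x (w + c *: delta_mx ord0 i) f (a + c * partial i f x).
Proof.
move=> /is_derive_epsP fw df cf; apply/is_derive_epsP => e e0.
have [|r1 r10 r1P] := fw (e / 2); first by rewrite divr_gt0.
have c1 : 0 < `|c| + 1 by rewrite ltr_wpDl.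
move/cvgrPdist_le : cf => /(_ (e / 2 / (`|c| + 1))) cf.
have {}cf : \forall y \near x,
    `|partial i f x - partial i f y| <= e / 2 / (`|c| + 1).
  by apply: cf; rewrite !divr_gt0.
have [r2 /= r20 r2P] := (nbhs_ballP _ _).1 (filterI df cf).
have wc1 : 0 < `|w| + `|c| + 1 by rewrite ltr_wpDl// addr_ge0.
exists (Num.min r1 (r2 / (`|w| + `|c| + 1))) => [|h].
  by rewrite lt_min r10 divr_gt0.
rewrite lt_min => /andP[hr1 hr2].
have near s : 0 <= s <= 1 ->
    ball x r2 (x + h *: w + s *: ((h * c) *: delta_mx ord0 i)).
  move=> /andP[s0 s1]; rewrite -ball_normE /ball_/= -addrA opprD addNKr normrN.
  have {}hr2 : `|h| * (`|w| + `|c| + 1) < r2 by rewrite -ltr_pdivlMr.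
  apply: le_lt_trans hr2; apply: (le_trans (ler_normD _ _)).
  rewrite !normrZ -addrA mulrDr lerD2l.
  apply: (@le_trans _ _ (1 * (`|h| * `|c| * 1))).
    apply: ler_pM; rewrite ?(ger0_norm s0) ?mulr_ge0//.
    by apply: ler_wpM2l; rewrite ?mulr_ge0 ?norm_delta_mx_le1.
  by rewrite mul1r mulr1 ler_wpM2l// lerDl.
have D s : 0 <= s <= 1 ->
    is_derive (x + h *: w + s *: ((h * c) *: delta_mx ord0 i))
      ((h * c) *: delta_mx ord0 i) f
      (h * c * partial i f (x + h *: w + s *: ((h * c) *: delta_mx ord0 i))).
  move=> /near /r2P [dfs _]; apply: is_deriveZv; exact: derivable_partial.
have [|s s01 E] := @mvt_segment _ _ f (x + h *: w) ((h * c) *: delta_mx ord0 i).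
  by move=> s /D[].
rewrite (@derive_val _ _ _ _ _ _ _ (D s s01)) in E.
rewrite scalerDr addrA scalerA.
have -> : f (x + h *: w + (h * c) *: delta_mx ord0 i) - f x
    - h * (a + c * partial i f x) =
  (f (x + h *: w) - f x - h * a) + h * c * (partial i f
    (x + h *: w + s *: ((h * c) *: delta_mx ord0 i)) - partial i f x).
  by move: E => /(canRL (subrK _)) ->; ring.
apply: (le_trans (ler_normD _ _)).
have -> : e * `|h| = e / 2 * `|h| + `|h| * (e / 2) by field.
apply: lerD; first exact: r1P.
rewrite normrM normrM -mulrA ler_wpM2l//.
have [_ /=] := r2P _ (near s s01); rewrite distrC.
rewrite ler_pdivlMr// [X in X <= _]mulrC => /(le_trans _); apply.
by rewrite ler_wpM2r// lerDl.
Qed.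

(** Continuity of the partial derivatives at the point lets the coordinates be
    changed one at a time, at the cost of an error controlled by the mean value
    theorem. *)
Lemma is_derive_C1 f x v :
  (forall i, \forall y \near x, derivable f y (delta_mx ord0 i)) ->
  (forall i, {for x, continuous (partial i f)}) ->
  is_derive x v f (dotp (gradient f x) v).
Proof.
move=> df cf; rewrite dotp_gradient {1}[v]row_sum_delta.
elim: (index_enum _) => [|i s IH].
  by rewrite !big_nil; apply: DeriveDef; [exact: derivable0|exact: derive0].
by rewrite !big_cons addrC [X in is_derive _ _ _ X]addrC; exact: is_derive_add_coord.
Qed.

Section convex.
Variable f : 'rV[R]_n -> R.
Hypothesis fconvex : forall (x y : 'rV[R]_n) (t : R), 0 <= t <= 1 ->
  f (t *: x + (1 - t) *: y) <= t * f x + (1 - t) * f y.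
Variable x : 'rV[R]_n.
Hypothesis df : forall i, derivable f x (delta_mx ord0 i).

(** A bound for the one-sided derivative along [v] in the form that convexity
    makes subadditive in [v]. *)
Let upper v (a : R) := forall e : R, 0 < e -> exists2 r : R, 0 < r &
  forall t : R, 0 < t < r -> f (x + t *: v) <= f x + t * (a + e).

Let upperD v w (a b : R) : upper v a -> upper w b -> upper (v + w) (a + b).
Proof.
move=> va wb e e0.
have [|r1 r10 r1P] := va (e / 2); first by rewrite divr_gt0.
have [|r2 r20 r2P] := wb (e / 2); first by rewrite divr_gt0.
exists (Num.min r1 r2 / 2) => [|t]; first by rewrite divr_gt0// lt_min r10.
rewrite ltr_pdivlMr// lt_min => /andP[t0 /andP[t1 t2]].
have := r1P (t * 2); rewrite mulr_gt0// t1 => /(_ isT) H1.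
have := r2P (t * 2); rewrite mulr_gt0// t2 => /(_ isT) H2.
have -> : x + t *: (v + w) =
    2^-1 *: (x + (t * 2) *: v) + (1 - 2^-1) *: (x + (t * 2) *: w).
  apply/rowP => i; rewrite !mxE; by field.
apply: (le_trans (@fconvex _ _ 2^-1 _)); first lra.
lra.
Qed.

Let upper_dotp v : upper v (dotp (gradient f x) v).
Proof.
rewrite dotp_gradient {1}[v]row_sum_delta.
elim: (index_enum _) => [|i s IH].
  rewrite !big_nil => e e0; exists 1 => // t /andP[t0 _].
  by rewrite scaler0 addr0 add0r lerDl mulr_ge0// ltW.
rewrite !big_cons; apply: upperD => //.
have /is_derive_epsP D := is_deriveZv (v ord0 i) (derivable_partial (@df i)).
move=> e /D[r r0 rP]; exists r => // t /andP[t0 tr].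
have := rP t; rewrite gtr0_norm// => /(_ tr); rewrite ler_norml => /andP[_].
by rewrite mulrDr [e * t]mulrC; lra.
Qed.

(** A convex function is above its tangent plane as soon as it has partial
    derivatives: its one-sided derivative along [- v] is at most the expected
    value, so convexity on the line bounds it from below along [v]. *)
Lemma convex_ge_tangent v : f x + dotp (gradient f x) v <= f (x + v).
Proof.
apply/ler_addgt0Pr => e e0.
have [r r0 rP] := @upper_dotp (- v) e e0.
pose t := Num.min (r / 2) 1.
have t0 : 0 < t by rewrite lt_min ltr01 divr_gt0.
have tr : t < r by rewrite /t gt_min; apply/orP; left; lra.
have := rP t; rewrite t0 tr => /(_ isT); rewrite dotpNr => H.
have t1 : 0 < 1 + t by lra.
have := @fconvex (x + t *: - v) (x + v) (1 + t)^-1.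
have -> : (1 + t)^-1 *: (x + t *: - v) + (1 - (1 + t)^-1) *: (x + v) = x.
  apply/rowP => i; rewrite !mxE; field; lra.
rewrite invr_ge0 ltW//= invf_le1// lerDl ltW// => /(_ isT).
rewrite -(ler_pM2l t1) mulrDr !mulrA divff ?gt_eqF// mul1r.
have -> : (1 + t) * (1 - (1 + t)^-1) = t by field; lra.
move=> H'; suff: t * (f x + dotp (gradient f x) v) <= t * (f (x + v) + e).
  by rewrite ler_pM2l.
rewrite !mulrDr in H *; lra.
Qed.

(** The upper bounds along [v] and [- v] control the difference quotients from one
    side, and the tangent plane controls them from the other. *)
Lemma convex_is_derive v : is_derive x v f (dotp (gradient f x) v).
Proof.
apply/is_derive_epsP => e e0.
have [r1 r10 r1P] := @upper_dotp v e e0.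
have [r2 r20 r2P] := @upper_dotp (- v) e e0.
exists (Num.min r1 r2) => [|h]; first by rewrite lt_min r10.
rewrite lt_min => /andP[h1 h2].
have L := convex_ge_tangent (h *: v); rewrite dotpZr in L.
have U : f (x + h *: v) <= f x + h * dotp (gradient f x) v + e * `|h|.
  have [h0|h0|<-] := ltgtP 0 h.
  - have := r1P h; rewrite h0 -{1}(gtr0_norm h0) h1 => /(_ isT).
    by rewrite (gtr0_norm h0) mulrDr; lra.
  - have := r2P (- h); rewrite oppr_gt0 h0 -{1}(ltr0_norm h0) h2 => /(_ isT).
    by rewrite scaleNr scalerN opprK dotpNr (ltr0_norm h0) mulrDr; lra.
  - by rewrite scale0r mul0r normr0 mulr0 !addr0.
by rewrite ger0_norm; lra.
Qed.

End convex.

End gateaux.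

(** * Functions with continuous iterated partial derivatives *)

Section Ck_theory.
Context {R : realType} {n : nat}.
Implicit Types (f g : 'rV[R]_n -> R) (x v w : 'rV[R]_n) (U : set 'rV[R]_n).

Lemma CkS k U f : Ck k.+1 U f -> Ck k U f.
Proof.
elim: k f => [|k IH] f [cf df]; first by split.
by split=> // i; have [d1 d2] := df i; split=> //; apply: IH.
Qed.

(** Differentiation is local, which is why [U] has to be open. *)
Lemma Ck_ext k U f g : open U -> (forall x, U x -> f x = g x) ->
  Ck k U f -> Ck k U g.
Proof.
move=> oU.
have near_fg f' g' x : (forall x, U x -> f' x = g' x) -> U x ->
    \forall y \near x, f' y = g' y.
  move=> fg Ux; have : \forall y \near x, U y by exact: open_nbhs_nbhs.
  by apply: filterS => y; exact: fg.
have cts_fg f' g' x : (forall x, U x -> f' x = g' x) -> U x ->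
    {for x, continuous f'} -> {for x, continuous g'}.
  move=> fg Ux cf; rewrite /prop_for /continuous_at -fg//.
  apply: cvg_trans cf.
  exact: (@near_eq_cvg _ _ (nbhs x) (nbhs_filter x) _ _ (near_fg _ _ _ fg Ux)).
elim: k f g => [|k IH] f g fg [cf df].
  by split=> // x Ux; apply: cts_fg fg Ux (cf x Ux).
split=> [x Ux|i]; first exact: cts_fg fg Ux (cf x Ux).
have [df1 df2] := df i; split.
  by move=> x Ux; apply: near_eq_derivable (df1 x Ux); exact: near_fg.
apply: IH df2 => x Ux; apply: near_eq_derive; exact: near_fg.
Qed.

Lemma Ck_cst k U (c : R) : open U -> Ck k U (fun=> c).
Proof.
move=> oU; elim: k c => [|k IH] c; split=> //; first by move=> x _; exact: cst_continuous.
  by move=> x _; exact: cst_continuous.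
move=> i; split=> [x _|]; first exact: derivable_cst.
by apply: Ck_ext oU _ (IH 0) => x _; rewrite /partial derive_cst.
Qed.

Lemma CkD k U f g : open U -> Ck k U f -> Ck k U g ->
  Ck k U (fun x => f x + g x).
Proof.
move=> oU; elim: k f g => [|k IH] f g [cf df] [cg dg]; split=> //.
- by move=> x Ux; apply: continuousD; [exact: cf|exact: cg].
- by move=> x Ux; apply: continuousD; [exact: cf|exact: cg].
move=> i; have [df1 df2] := df i; have [dg1 dg2] := dg i; split.
  by move=> x Ux; apply: derivableD; [exact: df1|exact: dg1].
apply: Ck_ext oU _ (IH _ _ df2 dg2) => x Ux.
by rewrite /partial -deriveD//; [exact: df1|exact: dg1].
Qed.

Lemma CkM k U f g : open U -> Ck k U f -> Ck k U g ->
  Ck k U (fun x => f x * g x).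
Proof.
move=> oU; elim: k f g => [|k IH] f g [cf df] [cg dg]; split=> //.
- by move=> x Ux; apply: continuousM; [exact: cf|exact: cg].
- by move=> x Ux; apply: continuousM; [exact: cf|exact: cg].
move=> i; have [df1 df2] := df i; have [dg1 dg2] := dg i; split.
  by move=> x Ux; apply: derivableM; [exact: df1|exact: dg1].
apply: Ck_ext oU _ (CkD oU (IH _ _ (@CkS k U f (conj cf df)) dg2)
  (IH _ _ (@CkS k U g (conj cg dg)) df2)) => x Ux.
by rewrite /partial [RHS](deriveM (df1 x Ux) (dg1 x Ux)).
Qed.

Lemma CkV k U f : open U -> (forall x, U x -> f x != 0) -> Ck k U f ->
  Ck k U (fun x => (f x)^-1).
Proof.
move=> oU f0; elim: k => [|k IH] [cf df]; split=> //.
- by move=> x Ux; apply: continuousV; [exact: f0|exact: cf].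
- by move=> x Ux; apply: continuousV; [exact: f0|exact: cf].
move=> i; have [df1 df2] := df i; split.
  by move=> x Ux; apply: derivableV; [exact: f0|exact: df1].
have CV := IH (@CkS k U f (conj cf df)).
apply: Ck_ext oU _ (CkM oU (CkM oU (Ck_cst k (- 1) oU) (CkM oU CV CV)) df2).
move=> x Ux; rewrite /partial [RHS](deriveV (f0 x Ux) (df1 x Ux)) /=.
by rewrite -[RHS]/(_ * _) mulN1r -invfM -expr2.
Qed.

Lemma is_derive_scale f x v (c d : R) :
  is_derive (c *: x) v f d -> is_derive x v (fun y => f (c *: y)) (c * d).
Proof.
move=> /(is_deriveZv c) /is_derive_epsP H; apply/is_derive_epsP => e e0.
have [r r0 rP] := H e e0; exists r => // h /rP.
by rewrite scalerDr !scalerA (mulrC h).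
Qed.

Lemma Ck_scale k f (c : R) : Ck k setT f -> Ck k setT (fun x => f (c *: x)).
Proof.
have cts g : (forall x, {for x, continuous g}) ->
    forall x, {for x, continuous (fun x => g (c *: x))}.
  move=> cg x; apply: (@continuous_comp _ _ _ (fun y : 'rV[R]_n => c *: y) g).
    exact: scaler_continuous.
  exact: cg.
elim: k f => [|k IH] f [cf df]; split=> //.
- by move=> x _; apply: cts => y; exact: cf.
- by move=> x _; apply: cts => y; exact: cf.
move=> i; have [df1 df2] := df i.
have D x : is_derive x (delta_mx ord0 i) (fun y => f (c *: y))
    (c * partial i f (c *: x)).
  by apply: is_derive_scale; apply: derivable_partial; exact: df1.
split=> [x _|]; first by have [] := D x.
apply: Ck_ext openT _ (CkM openT (Ck_cst k c openT) (IH _ df2)) => x _.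
by have [_ /esym] := D x.
Qed.

End Ck_theory.

(** * Norms on row vectors *)

Section norms.
Context {R : realType} {n : nat}.
Variable N : 'rV[R]_n -> R.
Hypothesis N_ge0 : forall x, 0 <= N x.
Hypothesis N_D : forall x y, N (x + y) <= N x + N y.
Hypothesis N_Z : forall (t : R) x, N (t *: x) = `|t| * N x.

(** Expanding in the canonical basis: this is where the dimension being finite
    makes all norms comparable. *)
Lemma seminorm_bounded : exists2 C : R, 0 < C & forall x, N x <= C * `|x|.
Proof.
exists (\sum_i N (delta_mx ord0 i) + 1) => [|x].
  by rewrite ltr_wpDl// sumr_ge0.
apply: (@le_trans _ _ (\sum_i N (delta_mx ord0 i) * `|x|)); last first.
  by rewrite -mulr_suml ler_wpM2r// lerDl.
rewrite {1}[x]row_sum_delta.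
elim: (index_enum _) => [|i s IH].
  by rewrite !big_nil -(scale0r 0) N_Z normr0 mul0r.
rewrite !big_cons; apply: (le_trans (N_D _ _)); apply: lerD => //.
by rewrite N_Z mulrC ler_wpM2l// coord_le_norm.
Qed.

Lemma seminorm_sub x y : `|N x - N y| <= N (x - y).
Proof.
have H a b : N a - N b <= N (a - b) by rewrite lerBlDr -{1}(subrK b a) N_D.
have NN a : N (- a) = N a by rewrite -scaleN1r N_Z normrN1 mul1r.
by rewrite ler_norml H andbT lerNl opprB -(NN (x - y)) opprB H.
Qed.

End norms.

Section limits.
Context {R : realType}.

Lemma lipschitz_cts n (f : 'rV[R]_n -> R) (C : R) :
  (forall x y, `|f x - f y| <= C * `|x - y|) ->
  continuous f.
Proof.
move=> fC x; apply/(@cvgrPdist_le _ _ _ (nbhs x) (nbhs_filter x)) => e e0.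
have C1 : 0 < `|C| + 1 by rewrite ltr_wpDl.
have r0 : 0 < e / (`|C| + 1) by rewrite divr_gt0.
apply: filterS (nbhsx_ballx x _ r0) => y; rewrite -ball_normE /ball_/= => xy.
apply: (le_trans (fC _ _)).
apply: (@le_trans _ _ ((`|C| + 1) * `|x - y|)).
  by rewrite ler_wpM2r// (le_trans (ler_norm _))// lerDl.
by rewrite mulrC -ler_pdivlMr// ltW.
Qed.

Lemma cvg_sum_fin (T I : Type) (G : set_system T) (s : seq I) (f : I -> T -> R)
    (l : I -> R) : Filter G -> (forall i, f i x @[x --> G] --> l i) ->
  (\sum_(i <- s) f i x) @[x --> G] --> \sum_(i <- s) l i.
Proof.
move=> FG fl; elim: s => [|i s IH].
  by rewrite big_nil; under eq_fun do rewrite big_nil; exact: cvg_cst.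
by rewrite big_cons; under eq_fun do rewrite big_cons; exact: cvgD.
Qed.

End limits.

Section finsler_norm.
Context {R : realType} {n : nat}.
Variable F : 'rV[R]_n -> R.
Hypothesis hF : strongly_convex_norm F.
Implicit Types (xi eta p : 'rV[R]_n).

Let FZ := scn_homogeneous hF.
Let F_ge0 := scn_ge0 hF.

Lemma finsler_convex x y (t : R) : 0 <= t <= 1 ->
  F (t *: x + (1 - t) *: y) <= t * F x + (1 - t) * F y.
Proof.
move=> /andP[t0 t1].
have := @scn_convex _ _ _ hF (Itv01 t0 t1) x y.
by rewrite !in_setT => /(_ isT isT).
Qed.

Lemma finslerD x y : F (x + y) <= F x + F y.
Proof.
have := @finsler_convex (2 *: x) (2 *: y) 2^-1.
rewrite !scalerA (_ : 1 - 2^-1 = 2^-1 :> R); last by field.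
rewrite mulVf// !scale1r !FZ gtr0_norm// !mulrA mulVf// !mul1r; apply.
by rewrite invr_ge0//= invf_le1//; lra.
Qed.

Lemma finsler0 : F 0 = 0.
Proof. by rewrite -(scale0r 0) FZ normr0 mul0r. Qed.

Lemma finslerN x : F (- x) = F x.
Proof. by rewrite -scaleN1r FZ normrN1 mul1r. Qed.

Lemma finsler_gt0 xi : xi != 0 -> 0 < F xi.
Proof.
move=> xi0; have [a a0 aP] := scn_coercive hF.
apply: lt_le_trans (aP xi); rewrite mulr_gt0//.
by apply: lt_le_trans (norm_le_euclidean xi); rewrite normr_gt0.
Qed.

Lemma finsler_continuous : continuous F.
Proof.
have [C C0 CP] := seminorm_bounded F_ge0 finslerD FZ.
apply: (@lipschitz_cts _ _ _ C) => x y.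
exact: le_trans (seminorm_sub finslerD FZ _ _) (CP _).
Qed.

Let U0 : set 'rV[R]_n := [set xi | xi != 0].

Lemma open_neq0 : open U0.
Proof.
rewrite (_ : U0 = ~` [set 0]); last by apply/seteqP; split=> x /=; [move/eqP|move/eqP].
exact: closed_openC (@accessible_closed_set1 _ (hausdorff_accessible (@norm_hausdorff _ _)) _).
Qed.

Lemma finsler_derivable p i : p != 0 -> derivable F p (delta_mx ord0 i).
Proof. by have [_ /(_ i) [H _]] := scn_C2 hF; exact: H. Qed.

(** The increment of a sublinear function is at most its value at the displacement,
    and at least the linear part, by convexity. *)
Lemma dotp_grad_finsler_le p eta : p != 0 -> dotp (gradient F p) eta <= F eta.
Proof.
move=> p0.
have := convex_ge_tangent finsler_convex (fun i => @finsler_derivable p i p0) eta.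
by move=> H; have := le_trans H (finslerD p eta); rewrite lerD2l.
Qed.

(** Euler's identity; one inequality is the previous bound, the other is the
    tangent plane at [p] evaluated at the origin. *)
Lemma dotp_grad_finsler_id p : p != 0 -> dotp (gradient F p) p = F p.
Proof.
move=> p0; apply/eqP; rewrite eq_le dotp_grad_finsler_le//=.
have := convex_ge_tangent finsler_convex (fun i => @finsler_derivable p i p0) (- p).
by rewrite subrr finsler0 dotpNr subr_le0.
Qed.

End finsler_norm.

(** * Strong convexity of the squared norm *)

Section strong_convexity.
Context {R : realType} {n : nat}.
Variable F : 'rV[R]_n -> R.
Hypothesis hF : strongly_convex_norm F.
Implicit Types (xi eta p : 'rV[R]_n).

Let FZ := scn_homogeneous hF.
Let F_ge0 := scn_ge0 hF.
Let H eta := F eta ^+ 2.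
Let U0 : set 'rV[R]_n := [set xi | xi != 0].
Let oU0 : open U0 := @open_neq0 R n.

Let CkH : Ck 2 U0 H.
Proof.
apply: Ck_ext oU0 _ (CkM oU0 (scn_C2 hF) (scn_C2 hF)) => x _.
by rewrite /H expr2.
Qed.

Let nbhsU0 xi : xi != 0 -> \forall y \near xi, U0 y.
Proof. by move=> xi0; exact: open_nbhs_nbhs. Qed.

Let HZ (t : R) xi : H (t *: xi) = t ^+ 2 * H xi.
Proof. by rewrite /H FZ exprMn -normrX ger0_norm// sqr_ge0. Qed.

Let D1 xi i : xi != 0 -> is_derive xi (delta_mx ord0 i) H (partial i H xi).
Proof.
by move=> xi0; apply: derivable_partial; have [_ /(_ i)[+ _]] := CkH; exact.
Qed.

Let D2 xi i j : xi != 0 ->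
  is_derive xi (delta_mx ord0 i) (partial j H) (hessian H xi i j).
Proof.
move=> xi0; rewrite mxE; apply: derivable_partial.
by have [_ /(_ j)[_ [_ /(_ i)[+ _]]]] := CkH; exact.
Qed.

Let partialZ (t : R) xi i : 0 < t -> xi != 0 ->
  partial i H (t *: xi) = t * partial i H xi.
Proof.
move=> t0 xi0.
have txi0 : t *: xi != 0 by rewrite scaler_eq0 negb_or gt_eqF.
have [_ A] := is_derive_scale (D1 i txi0).
have : (fun y => H (t *: y)) = t ^+ 2 *: H by apply/funext => y; rewrite HZ.
move=> E; rewrite E deriveZ in A; last by have [] := D1 i xi0.
apply/esym/(mulfI (lt0r_neq0 t0)); rewrite -A mulrA -expr2.
by [].
Qed.

Let hessianZ (t : R) xi : 0 < t -> xi != 0 ->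
  hessian H (t *: xi) = hessian H xi.
Proof.
move=> t0 xi0; apply/matrixP => i j.
have txi0 : t *: xi != 0 by rewrite scaler_eq0 negb_or gt_eqF.
have [_ A] := is_derive_scale (D2 i j txi0).
have B : is_derive xi (delta_mx ord0 i) (t *: partial j H) (t * hessian H xi i j).
  by apply: is_deriveZ; exact: D2.
have [_ C] : is_derive xi (delta_mx ord0 i) (fun y => partial j H (t *: y))
    (t * hessian H xi i j).
  apply: near_eq_is_derive B.
  by apply: filterS (nbhsU0 xi0) => y y0; rewrite partialZ.
exact: (mulfI (lt0r_neq0 t0) (etrans (esym A) C)).
Qed.

Let q xi eta := dotp (eta *m hessian H xi) eta.

Let qE xi eta :
  q xi eta = \sum_j \sum_i eta ord0 i * hessian H xi i j * eta ord0 j.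
Proof.
by apply: eq_bigr => j _; rewrite mxE mulr_suml.
Qed.

Let q_cts xi eta : xi != 0 ->
  {for (xi, eta), continuous (fun p : 'rV[R]_n * 'rV[R]_n => q p.1 p.2)}.
Proof.
move=> xi0; rewrite /prop_for /continuous_at.
under eq_fun do rewrite qE.
rewrite qE; apply: cvg_sum_fin => j; apply: cvg_sum_fin => i.
have C k : (fun p : 'rV[R]_n * 'rV[R]_n => p.2 ord0 k) @ nbhs (xi, eta) -->
    eta ord0 k.
  apply: (@continuous_comp _ _ _ (@snd 'rV[R]_n 'rV[R]_n)
    (fun e : 'rV[R]_n => e ord0 k) (xi, eta)); first exact: cvg_snd.
  exact: coord_continuous.
apply: cvgM => //; apply: cvgM => //.
apply: (@continuous_comp _ _ _ (@fst 'rV[R]_n 'rV[R]_n)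
  (fun x : 'rV[R]_n => hessian H x i j) (xi, eta)); first exact: cvg_fst.
have -> : (fun x : 'rV[R]_n => hessian H x i j) = partial i (partial j H).
  by apply/funext => x; rewrite mxE.
by have [_ /(_ j)[_ [_ /(_ i)[_ [+ _]]]]] := CkH; exact.
Qed.

(** Homogeneity reduces the lower bound to a product of two unit spheres, which
    is compact. *)
Lemma finsler_hessian_ge : exists2 l : R, 0 < l & forall xi eta, xi != 0 ->
  l * dotp eta eta <= q xi eta.
Proof.
pose S : set 'rV[R]_n := [set x | `|x| = 1].
have S0 x : x != 0 -> S (`|x|^-1 *: x).
  by move=> x0; rewrite /S/= normrZ normfV normr_id mulVf// normr_eq0.
have [Sne|/nonemptyPn Se] := pselect (S !=set0); last first.
  exists 1 => // xi eta /S0; by rewrite Se.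
have cS : compact S.
  apply: bounded_closed_compact.
    by exists 1; split=> // M M1 x /= ->; exact: ltW.
  rewrite (_ : S = (fun x : 'rV[R]_n => `|x|) @^-1` [set 1]); last by [].
  apply: preimage_closed; first by move=> x _; exact: norm_continuous.
  exact: (@accessible_closed_set1 _ (hausdorff_accessible (@norm_hausdorff _ _)) _).
have [||[x0 e0] /set_mem/= [Sx0 Se0] qmin] :=
    @compact_EVT_min _ R (fun p : 'rV[R]_n * 'rV[R]_n => q p.1 p.2) (S `*` S) _
      (compact_setX cS cS).
- by have [x Sx] := Sne; exists (x, x).
- apply: continuous_in_subspaceT => -[x y] /set_mem/= [Sx _]; apply: q_cts.
  by rewrite -normr_eq0 Sx oner_eq0.
have q0 : 0 < q x0 e0.
  by apply: (scn_hessian hF); rewrite -normr_eq0 ?Sx0 ?Se0 oner_eq0.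
exists (q x0 e0 / n.+1%:R) => [|xi eta xi0]; first by rewrite divr_gt0.
have [->|eta0] := eqVneq eta 0; first by rewrite (dotp0r 0) mulr0 /q (dotp0r (0 *m _)).
have qxe : q x0 e0 <= q xi (`|eta|^-1 *: eta).
  rewrite /q -(@hessianZ `|xi|^-1 xi)//; last by rewrite invr_gt0 normr_gt0.
  apply: (qmin (_, _)); rewrite inE /=; split; exact: S0.
have : q x0 e0 * `|eta| ^+ 2 <= q xi eta.
  rewrite -ler_pdivlMr ?exprn_gt0 ?normr_gt0//; apply: le_trans qxe _.
  rewrite /q -scalemxAl dotpZl dotpZr mulrA -invfM -expr2 mulrC.
  by [].
apply: le_trans; rewrite -mulrA ler_wpM2l ?(ltW q0)//.
rewrite ler_pdivrMl ?ltr0n//.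
apply: (le_trans (ler_norm _)); apply: (le_trans (dotp_le_norm _ _)).
by rewrite -expr2 ler_wpM2r ?sqr_ge0// ler_nat.
Qed.

Let line_avoids_near (x e : 'rV[R]_n) (r : R) : x + r *: e != 0 ->
  \forall s \near r, x + s *: e != 0.
Proof.
move=> /nbhsU0 N.
have c : (fun s : R => x + s *: e) @ nbhs r --> x + r *: e.
  by apply: cvgD; [exact: cvg_cst|apply: cvgZr_tmp; exact: cvg_id].
exact: c N.
Qed.

Let Dline1 x e (r : R) : x + r *: e != 0 ->
  is_derive r 1 (fun s => H (x + s *: e)) (dotp (gradient H (x + r *: e)) e).
Proof.
move=> re0; apply/is_derive_line; apply: is_derive_C1 => i.
  by apply: filterS (nbhsU0 re0) => y y0; have [] := D1 i y0.
by have [_ /(_ i)[_ [+ _]]] := CkH; exact.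
Qed.

Let Dline2 x e (r : R) : x + r *: e != 0 ->
  is_derive r 1 (fun s => dotp (gradient H (x + s *: e)) e) (q (x + r *: e) e).
Proof.
move=> re0.
have E : (fun s => dotp (gradient H (x + s *: e)) e) =
    \sum_(j < n) (e ord0 j *: (fun s : R => partial j H (x + s *: e))).
  by apply/funext => s; rewrite dotp_gradient fct_sumE.
rewrite E qE; apply: is_derive_sum => j.
rewrite -mulr_suml mulrC; apply: is_deriveZ.
apply/is_derive_line.
suff -> : \sum_i e ord0 i * hessian H (x + r *: e) i j =
    dotp (gradient (partial j H) (x + r *: e)) e.
  apply: is_derive_C1 => i.
    by apply: filterS (nbhsU0 re0) => y y0; have [] := D2 i j y0.
  by have [_ /(_ j)[_ [_ /(_ i)[_ [+ _]]]]] := CkH; exact.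
by rewrite dotp_gradient; apply: eq_bigr => i _; rewrite mxE.
Qed.

(** The bound on the Hessian gives a bound on the second derivative along a segment
    that avoids the origin, where the norm is not differentiable. On a segment
    through the origin the squared norm is an explicit quadratic polynomial, by
    homogeneity. *)
Lemma finsler_strongly_convex : exists2 l : R, 0 < l &
  forall xi1 xi2 (t : R), 0 <= t <= 1 ->
    F (t *: xi1 + (1 - t) *: xi2) ^+ 2
      + l * (t * (1 - t) * dotp (xi1 - xi2) (xi1 - xi2)) <=
    t * F xi1 ^+ 2 + (1 - t) * F xi2 ^+ 2.
Proof.
have [l0 l00 l0P] := finsler_hessian_ge.
have [a a0 aP] := scn_coercive hF.
pose l := Num.min (l0 / 2) (a ^+ 2).
have lpos : 0 < l by rewrite lt_min divr_gt0//= exprn_gt0.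
exists l => // xi1 xi2 t /andP[t0 t1].
rewrite -[dotp _ _]/(dotp (xi1 - xi2) (xi1 - xi2)).
set e := xi2 - xi1.
have -> : dotp (xi1 - xi2) (xi1 - xi2) = dotp e e.
  by rewrite -opprB dotpNl dotpNr opprK.
have mE : t *: xi1 + (1 - t) *: xi2 = xi1 + (1 - t) *: e.
  by apply/rowP => i; rewrite !mxE; ring.
rewrite mE -!/(H _).
have [[s /andP[s0 s1] se0]|seg] := pselect (exists2 s : R, 0 <= s <= 1 &
    xi1 + s *: e = 0).
  have x1E : xi1 = (- s) *: e by rewrite scaleNr; apply/eqP; rewrite -addr_eq0 se0.
  have x2E : xi2 = (1 - s) *: e by rewrite scalerBl scale1r -scaleNr -x1E /e subrK.
  rewrite [X in H (X + _)]x1E -scalerDl [X in t * H X]x1E [X in (1 - t) * H X]x2E !HZ.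
  have lH : l * dotp e e <= H e.
    apply: (@le_trans _ _ (a ^+ 2 * dotp e e)).
      by rewrite ler_wpM2r ?dotp_ge0// ge_min lexx orbT.
    rewrite -[dotp e e]sqr_sqrtr ?dotp_ge0// -exprMn.
    by rewrite ler_pXn2r ?nnegrE ?F_ge0 ?aP// mulr_ge0 ?sqrtr_ge0// ltW.
  have tt : 0 <= t * (1 - t) by rewrite mulr_ge0// subr_ge0.
  have := ler_wpM2l tt lH; move: (H e) (dotp e e) => h d; lra.
have av r : 0 <= r <= 1 -> xi1 + r *: e != 0.
  by move=> r01; apply/eqP => re; apply: seg; exists r.
pose g (r : R) := H (xi1 + r *: e) - l * dotp e e * r ^+ 2.
have Dsq (r : R) : is_derive r 1 (fun r : R => l * dotp e e * r ^+ 2)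
    (l * dotp e e * (2 * r)).
  rewrite (_ : (2 * r) = 'D_1 (fun r : R => r ^+ 2) r).
    by apply: is_deriveZ; apply: derivableP; exact: exprn_derivable.
  rewrite exp_derive expr1 -[X in _ = X]/(2 *: r * 1) mulr1.
  by rewrite scaler_nat mulr_natl.
have Dg (r : R) : xi1 + r *: e != 0 -> is_derive r 1 g
    (dotp (gradient H (xi1 + r *: e)) e - l * dotp e e * (2 * r)).
  by move=> /Dline1 D; apply: is_deriveB.
have Dg2 (r : R) : xi1 + r *: e != 0 -> is_derive r 1 ('D_1 g)
    (q (xi1 + r *: e) e - l * dotp e e * 2).
  move=> re; apply: (@near_eq_is_derive _ _ _
    (fun r : R => dotp (gradient H (xi1 + r *: e)) e - l * dotp e e * (2 * r))).
    apply: filterS (line_avoids_near re) => s /Dg [_ ->] //.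
  apply: is_deriveB; first exact: Dline2.
  under eq_fun do rewrite mulrA.
  rewrite -[X in is_derive _ _ _ X]mulr1.
  by apply: is_deriveZ; exact: is_derive_id.
have gc (r : R) : 0 <= r <= 1 -> g @ nbhs r --> g r.
  move=> /av /Dg [+ _] => /derivable1_diffP /differentiable_continuous; exact.
have itv (r : R) : r \in `]0, 1[ -> 0 <= r <= 1.
  by rewrite in_itv/= => /andP[r0 r1]; rewrite !ltW.
have G : g (1 - t) <= t * g 0 + (1 - t) * g 1.
  have := @second_derivative_convex R g 0 1 _ _ _ _ _ (Itv01 t0 t1) ler01.
  rewrite !convRE /= mulr0 add0r mulr1; apply.
  - move=> r /andP[r0 r1]; have r01 : 0 <= r <= 1 by rewrite !ltW.
    have [_ ->] := Dg2 r (av r r01).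
    have := l0P (xi1 + r *: e) e (av r r01).
    have : l * dotp e e <= l0 / 2 * dotp e e.
      by rewrite ler_wpM2r ?dotp_ge0// ge_min lexx.
    by move: (q _ _) (dotp e e) => Q D; lra.
  - by apply: cvg_at_left_filter; apply: gc; rewrite ler01 lexx.
  - by apply: cvg_at_right_filter; apply: gc; rewrite ler01 lexx.
  - by move=> r /itv /av /Dg [].
  - by move=> r /itv /av /Dg2 [].
move: G; rewrite /g scale0r addr0 expr0n/= mulr0 subr0 scale1r expr1n mulr1.
rewrite [X in (1 - t) * (H X - _)](_ : _ = xi2); last by rewrite /e addrC subrK.
by move: (H _) (H _) (H _) (dotp e e) => h1 h2 h3 D; nra.
Qed.

End strong_convexity.

(** * The polar norm *)

Section polar.
Context {R : realType} {n : nat}.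
Variable F : 'rV[R]_n -> R.
Hypothesis hF : strongly_convex_norm F.
Implicit Types (x y z v xi : 'rV[R]_n).

Let FZ := scn_homogeneous hF.
Let F_ge0 := scn_ge0 hF.
Let FD := finslerD hF.

(** The sign condition on [c] accounts for dimension 0, where the polar function is
    the supremum of the empty set. *)
Lemma polar_le x (c : R) : 0 <= c ->
  (forall xi, xi != 0 -> dotp xi x <= c * F xi) -> polar F x <= c.
Proof.
move=> c0 H; rewrite /polar.
set A := (X in sup X); have [A0|/nonemptyPn ->] := pselect (A !=set0); last by rewrite sup0.
apply: ge_sup => // _ [xi /= xi0 <-].
by rewrite ler_pdivrMr ?H// finsler_gt0.
Qed.

Lemma polar_ge x xi : dotp xi x <= F xi * polar F x.
Proof.
have [->|xi0] := eqVneq xi 0; first by rewrite dotpC dotp0r finsler0// mul0r.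
rewrite mulrC -ler_pdivrMr ?finsler_gt0//; apply: ub_le_sup; last by exists xi.
have [a a0 aP] := scn_coercive hF.
exists (n%:R * `|x| / a) => _ [eta /= eta0 <-].
rewrite ler_pdivrMr ?finsler_gt0//.
apply: (le_trans (ler_norm _)); apply: (le_trans (dotp_le_norm _ _)).
rewrite [`|eta| * _]mulrC mulrA -[leRHS]mulrA ler_wpM2l ?mulr_ge0//.
rewrite ler_pdivlMl//; apply: le_trans (aP eta).
by rewrite ler_pM2l// norm_le_euclidean.
Qed.

Lemma polar_ge0 x : 0 <= polar F x.
Proof.
have [[xi xi0]|H] := pselect (exists xi : 'rV[R]_n, xi != 0).
  have H1 := polar_ge x xi; have := polar_ge x (- xi).
  rewrite finslerN// dotpNl => H2.
  have : 0 <= F xi * polar F x by lra.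
  by rewrite pmulr_rge0// finsler_gt0.
rewrite /polar (_ : [set _ | _ in _] = set0) ?sup0//.
by apply/seteqP; split=> // _ [xi /= xi0 _]; apply: H; exists xi.
Qed.

Lemma polarD x y : polar F (x + y) <= polar F x + polar F y.
Proof.
apply: polar_le => [|xi xi0]; first by rewrite addr_ge0 ?polar_ge0.
by rewrite dotpDr mulrDl lerD// mulrC polar_ge.
Qed.

Lemma polarZ (t : R) x : polar F (t *: x) = `|t| * polar F x.
Proof.
have H (s : R) y : polar F (s *: y) <= `|s| * polar F y.
  apply: polar_le => [|xi xi0]; first by rewrite mulr_ge0 ?polar_ge0.
  have -> : dotp xi (s *: y) = dotp (s *: xi) y by rewrite dotpZr dotpZl.
  by apply: (le_trans (polar_ge _ _)); rewrite FZ mulrAC.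
apply/eqP; rewrite eq_le H /=.
have [->|t0] := eqVneq t 0; first by rewrite normr0 mul0r polar_ge0.
have := H t^-1 (t *: x); rewrite scalerA mulVf// scale1r.
by rewrite normfV mulrC ler_pdivlMr ?normr_gt0// mulrC.
Qed.

Lemma polar_coercive : exists2 C : R, 0 < C & forall x, `|x| <= C * polar F x.
Proof.
have [C C0 CP] := seminorm_bounded F_ge0 FD FZ.
exists C => // x; have [->|x0] := eqVneq x 0.
  by rewrite normr0 mulr_ge0 ?polar_ge0// ltW.
have xpos : 0 < `|x| by rewrite normr_gt0.
rewrite -(ler_pM2l xpos) -expr2; apply: (le_trans (sqr_norm_le_dotp x)).
apply: (le_trans (polar_ge x x)).
by rewrite mulrA [`|x| * C]mulrC ler_wpM2r ?polar_ge0.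
Qed.

Lemma polar_lipschitz : exists2 C : R, 0 < C &
  forall x, polar F x <= C * `|x|.
Proof. exact: (seminorm_bounded polar_ge0 polarD polarZ). Qed.

Lemma polar_continuous : continuous (polar F).
Proof.
have [C C0 CP] := polar_lipschitz.
apply: (@lipschitz_cts _ _ _ C) => x y.
exact: le_trans (seminorm_sub polarD polarZ _ _) (CP _).
Qed.

Lemma legendre_le x xi : 2 * dotp xi x - F xi ^+ 2 <= polar F x ^+ 2.
Proof.
have := polar_ge x xi; have := sqr_ge0 (F xi - polar F x).
rewrite sqrrB; move: (dotp _ _) (F xi) (polar F x) => a b c.
by rewrite -mulr_natl; lra.
Qed.

(** With [legendre_le], this says that the square of the polar norm is, up to a
    factor, the Legendre transform of the squared norm. Each direction has to be
    scaled optimally for the bound on the quotient to follow. *)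
Lemma polar_sqr_le x (c : R) :
  (forall xi, 2 * dotp xi x - F xi ^+ 2 <= c) -> polar F x ^+ 2 <= c.
Proof.
move=> H.
have c0 : 0 <= c by have := H 0; rewrite finsler0// dotpC dotp0r mulr0 expr0n/= subr0.
suff : polar F x <= Num.sqrt c.
  move=> P; rewrite -[leRHS]sqr_sqrtr//.
  by rewrite ler_pXn2r ?nnegrE ?polar_ge0 ?sqrtr_ge0.
apply: polar_le => [|xi xi0]; first exact: sqrtr_ge0.
have F0 := finsler_gt0 hF xi0.
rewrite -ler_pdivrMr//; apply: (le_trans (ler_norm _)).
rewrite -sqrtr_sqr ler_wsqrtr//.
apply: le_trans (H ((dotp xi x / F xi ^+ 2) *: xi)).
rewrite dotpZl FZ [(_ * F xi) ^+ 2]exprMn -normrX ger0_norm ?sqr_ge0//.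
rewrite le_eqVlt; apply/orP; left; apply/eqP; field.
by rewrite gt_eqF.
Qed.

(** Duality turns the strong convexity of the square of the norm into
    semiconcavity of the square of the polar norm: for any two competitors in
    the suprema defining the left-hand side, their barycentre competes on the
    right, and completing the square absorbs the remaining cross term. *)
Lemma polar_sqr_semiconcave : exists2 C : R, 0 < C &
  forall x1 x2 (t : R), 0 <= t <= 1 ->
  t * polar F x1 ^+ 2 + (1 - t) * polar F x2 ^+ 2 <=
  polar F (t *: x1 + (1 - t) *: x2) ^+ 2
    + C * (t * (1 - t) * dotp (x1 - x2) (x1 - x2)).
Proof.
have [l l0 lP] := finsler_strongly_convex hF.
exists l^-1 => [|x1 x2 t]; first by rewrite invr_gt0.
move=> /andP[]; rewrite le_eqVlt => /predU1P[<- _|t0].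
  by rewrite !(mul0r, scale0r, subr0, mul1r, scale1r, mulr0, addr0, add0r).
rewrite le_eqVlt => /predU1P[->|t1].
  by rewrite !(subrr, mul0r, scale0r, subr0, mul1r, scale1r, mulr0, addr0, add0r).
set M := (X in _ <= X).
have s0 : 0 < 1 - t by rewrite subr_gt0.
suff H xi1 xi2 : t * (2 * dotp xi1 x1 - F xi1 ^+ 2) +
    (1 - t) * (2 * dotp xi2 x2 - F xi2 ^+ 2) <= M.
  rewrite -lerBrDr -ler_pdivlMl//; apply: polar_sqr_le => xi1.
  rewrite ler_pdivlMl// lerBrDr -lerBrDl -ler_pdivlMl//; apply: polar_sqr_le => xi2.
  rewrite ler_pdivlMl// lerBrDl; exact: H.
have := @lP xi1 xi2 t; rewrite (ltW t0) (ltW t1) => /(_ isT).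
have := legendre_le (t *: x1 + (1 - t) *: x2) (t *: xi1 + (1 - t) *: xi2).
have tt : 0 < t * (1 - t) by rewrite mulr_gt0.
have -> : t * (2 * dotp xi1 x1 - F xi1 ^+ 2) +
    (1 - t) * (2 * dotp xi2 x2 - F xi2 ^+ 2) =
    2 * (dotp (t *: xi1 + (1 - t) *: xi2) (t *: x1 + (1 - t) *: x2)
      + t * (1 - t) * dotp (xi1 - xi2) (x1 - x2))
    - (t * F xi1 ^+ 2 + (1 - t) * F xi2 ^+ 2).
  by rewrite !(dotpDl, dotpDr, dotpNl, dotpNr, dotpZl, dotpZr); ring.
have square : 2 * dotp (xi1 - xi2) (x1 - x2) - l * dotp (xi1 - xi2) (xi1 - xi2)
    <= l^-1 * dotp (x1 - x2) (x1 - x2).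
  rewrite -(ler_pM2l l0) mulrA divff ?gt_eqF// mul1r -subr_ge0.
  apply: le_trans (dotp_ge0 (x1 - x2 - l *: (xi1 - xi2))) _.
  rewrite le_eqVlt; apply/orP; left; apply/eqP.
  move: (x1 - x2) (xi1 - xi2) => z e.
  by rewrite !(dotpDl, dotpDr, dotpNl, dotpNr, dotpZl, dotpZr) (dotpC z e); ring.
have := ler_wpM2l (ltW tt) square; rewrite /M mulrBr (mulrCA _ l^-1).
rewrite !(mulrCA _ l) (mulrCA _ 2).
by lra.
Qed.

End polar.

(** * The distance to the boundary *)

Section distance.
Context {R : realType} {n : nat}.
Variable F : 'rV[R]_n -> R.
Hypothesis hF : strongly_convex_norm F.
Variable Omega : set 'rV[R]_n.
Hypothesis hbd : boundary Omega !=set0.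
Implicit Types (x y z v p : 'rV[R]_n).

Let N := polar F.
Let d := dist_boundary F Omega.
Let N_ge0 := polar_ge0 hF.
Let ND := polarD hF.
Let NZ := polarZ hF.

Lemma closed_boundary : closed (boundary Omega).
Proof.
rewrite /boundary setDE; apply: closedI; first exact: closed_closure.
exact/open_closedC/open_interior.
Qed.

Let NN x : N (- x) = N x.
Proof. by rewrite -scaleN1r /N NZ normrN1 mul1r. Qed.

Lemma dist_le x y : boundary Omega y -> d x <= N (x - y).
Proof.
move=> By; apply: ge_inf; last by exists y.
by exists 0 => _ [z Bz <-]; exact: N_ge0.
Qed.

Lemma dist_ge0 x : 0 <= d x.
Proof.
apply: lb_le_inf => [|_ [z Bz <-]]; last exact: N_ge0.
by have [y By] := hbd; exists (N (x - y)), y.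
Qed.

(** The norm is coercive, so only a compact part of the boundary competes for the
    infimum. *)
Lemma dist_attained x : exists2 y, boundary Omega y & d x = N (x - y).
Proof.
have [y0 By0] := hbd.
pose f y := N (x - y).
have cf : continuous f.
  move=> y; apply: (@continuous_comp _ _ _ (fun y : 'rV[R]_n => x - y) N).
    by apply: continuousB; [exact: cst_continuous|exact: cvg_id].
  exact: polar_continuous.
pose K := boundary Omega `&` f @^-1` [set r | r <= f y0].
have Ky0 : K y0 by split=> //=.
have cK : compact K.
  apply: bounded_closed_compact.
    have [C C0 CP] := polar_coercive hF.
    exists (`|x| + C * f y0); split; first exact: num_real.
    move=> M MP y [_ /= fy]; apply: le_trans (ltW MP).
    rewrite -[y](subKr x); apply: (le_trans (ler_normB _ _)); rewrite lerD2l.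
    by apply: (le_trans (CP _)); rewrite ler_pM2l.
  apply: closedI; first exact: closed_boundary.
  by apply: preimage_closed => [y _|]; [exact: cf|exact: closed_le].
have [||y] := @EVT_min_rV R n f K _ cK; first by exists y0.
  exact: continuous_subspaceT.
rewrite inE => -[By fy] miny; exists y => //.
apply/eqP; rewrite eq_le dist_le//=.
apply: lb_le_inf; first by exists (f y0); exists y0.
move=> _ [z Bz <-]; rewrite -/(f z) -/(f y).
have [fz|/ltW] := leP (f z) (f y0); first by apply: miny; rewrite inE.
exact: le_trans.
Qed.

Lemma dist_sub x z : `|d x - d z| <= N (x - z).
Proof.
have H a b : d a - d b <= N (a - b).
  have [y By ->] := dist_attained b.
  rewrite lerBlDr; apply: le_trans (dist_le _ By) _.
  by apply: le_trans (ND _ _); rewrite subrKA.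
by rewrite ler_norml H andbT lerNl opprB -(NN (x - z)) opprB H.
Qed.

Lemma dist_lipschitz : exists2 C : R, 0 < C &
  forall x z, `|d x - d z| <= C * `|x - z|.
Proof.
have [C C0 CP] := polar_lipschitz hF; exists C => // x z.
exact: le_trans (dist_sub _ _) (CP _).
Qed.

(** Semiconcavity with a fixed constant passes to infima: a nearest boundary point
    of the barycentre competes at both endpoints. *)
Lemma dist_sqr_semiconcave : exists2 C : R, 0 < C &
  forall x1 x2 (t : R), 0 <= t <= 1 ->
  t * d x1 ^+ 2 + (1 - t) * d x2 ^+ 2 <=
  d (t *: x1 + (1 - t) *: x2) ^+ 2 + C * (t * (1 - t) * dotp (x1 - x2) (x1 - x2)).
Proof.
have [C C0 CP] := polar_sqr_semiconcave hF; exists C => // x1 x2 t t01.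
have [y By ->] := dist_attained (t *: x1 + (1 - t) *: x2).
have := CP (x1 - y) (x2 - y) t t01.
have -> : t *: (x1 - y) + (1 - t) *: (x2 - y) = t *: x1 + (1 - t) *: x2 - y.
  by apply/rowP => i; rewrite !mxE; ring.
have -> : x1 - y - (x2 - y) = x1 - x2 by apply/rowP => i; rewrite !mxE; ring.
move=> H; apply: le_trans H; case/andP : t01 => t0 t1.
have sq x : d x ^+ 2 <= N (x - y) ^+ 2.
  by rewrite ler_pXn2r ?nnegrE ?dist_ge0 ?N_ge0// dist_le.
by apply: lerD; rewrite ler_wpM2l ?sq// subr_ge0.
Qed.

Lemma polar_gt0 x : x != 0 -> 0 < N x.
Proof.
have [C C0 CP] := polar_coercive hF.
by rewrite -normr_gt0 => x0; rewrite -(pmulr_rgt0 _ C0); exact: lt_le_trans (CP x).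
Qed.

Lemma dist_gt0 x : open Omega -> Omega x -> 0 < d x.
Proof.
move=> oO Ox; have [y By ->] := dist_attained x; apply: polar_gt0.
apply/negP => /eqP/subr0_eq xy.
by case: By => _; apply; rewrite -xy; exact: open_nbhs_nbhs.
Qed.

(** Moving from a point towards a nearest boundary point decreases the distance
    at unit speed, which is the fastest rate allowed by the norm. *)
Lemma finsler_grad_dist_ge1 x p : open Omega -> Omega x ->
  (forall v, is_derive x v d (dotp p v)) -> 1 <= F p.
Proof.
move=> oO Ox D; have d0 := dist_gt0 oO Ox.
have [y By dy] := dist_attained x.
have : dotp p (y - x) <= - d x.
  apply: is_derive_le (D (y - x)) _ => s /andP[s0 s1].
  have : d (x + s *: (y - x)) <= (1 - s) * d x.
    apply: (le_trans (dist_le _ By)); rewrite dy.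
    rewrite (_ : _ - y = (1 - s) *: (x - y)).
      by rewrite /N NZ ger0_norm// subr_ge0.
    by apply/rowP => i; rewrite !mxE; ring.
  by move: d0; move: (d x) (d _) => a b; lra.
rewrite -opprB dotpNr lerN2 => H.
have := le_trans H (polar_ge hF (x - y) p); rewrite -/(N _) -dy.
by rewrite -{1}[d x]mul1r ler_pM2r.
Qed.

(** The Lipschitz bound is tested in the direction [gradient F p], whose polar norm
    is at most 1 and whose pairing with [p] is [F p]. *)
Lemma finsler_grad_dist_le1 x p :
  (forall v, is_derive x v d (dotp p v)) -> F p <= 1.
Proof.
move=> D; have [->|p0] := eqVneq p 0; first by rewrite finsler0.
have dle v : dotp p v <= N v.
  apply: is_derive_le (D v) _ => s /andP[s0 s1].
  apply: (le_trans (ler_norm _)); apply: (le_trans (dist_sub _ _)).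
  by rewrite addrC addKr /N NZ gtr0_norm.
rewrite -(dotp_grad_finsler_id hF p0) dotpC; apply: (le_trans (dle _)).
apply: polar_le => // xi xi0; rewrite mul1r dotpC.
exact: dotp_grad_finsler_le.
Qed.

End distance.

(** * Translation invariance of the Lebesgue measure *)

Section lebesgue_translation.
Context {R : realType}.
Local Open Scope ereal_scope.

Lemma lebesgue_measure_shift (a : R) (A : set R) :
  measurable (A : set (measurableTypeR R)) ->
  lebesgue_measure ((fun x : R => (x + a)%R) @^-1` A) = lebesgue_measure A.
Proof.
move=> mA; apply/esym.
have mshift : measurable_fun setT (fun x : measurableTypeR R => (x + a)%R : measurableTypeR R).
  by apply: measurable_funD => //; exact: measurable_cst.
pose phi : {mfun measurableTypeR R >-> measurableTypeR R} :=
  HB.pack (fun x : measurableTypeR R => (x + a)%R : measurableTypeR R)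
    (isMeasurableFun.Build _ _ _ _ _ mshift).
apply: (@lebesgue_measure_unique _ (pushforward lebesgue_measure phi)) => //= _ [[b c]] _ <-.
rewrite /pushforward.
rewrite (_ : _ @^-1` _ = `](b - a)%R, (c - a)%R]%classic); last first.
  by apply/seteqP; split=> x /=; rewrite !in_itv/= ltrBlDr lerBrDr.
rewrite !lebesgue_measure_itv/= !lte_fin ltrD2r.
by case: ifP => // _; rewrite !EFinB -EFinB -EFinB -EFinB; congr EFin; ring.
Qed.

Lemma row_consD n (x : R) (y : 'rV[R]_n) (v : 'rV[R]_n.+1) :
  (row_cons (x, y) + v)%R =
  row_cons (x + v ord0 ord0, y + @rsubmx R 1 1 n v)%R.
Proof.
apply/rowP => i; rewrite mxE /row_cons /=; case: (@split_ordP 1 n i) => j ->.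
  rewrite [X in (X + _)%R](row_mxEl _ _ ord0 j) [RHS](row_mxEl _ _ ord0 j) !mxE.
  by congr (_ + v _ _)%R; apply: val_inj => /=; rewrite (ord1 j).
by rewrite [X in (X + _)%R](row_mxEr _ _ ord0 j) [RHS](row_mxEr _ _ ord0 j) !mxE.
Qed.

(** By induction on the dimension: slicing along the first coordinate, each slice is
    shifted, and so is the function that measures the slices. *)
Lemma lebesgue_row_shift n (v : 'rV[R]_n) (A : set 'rV[R]_n) : measurable A ->
  lebesgue_row n ((fun x => (x + v)%R) @^-1` A) = lebesgue_row n A.
Proof.
elim: n v A => [|n IH] v A mA.
  by congr (lebesgue_row 0 _); apply/seteqP; split=> x /=;
    rewrite (_ : (x + v)%R = x)//; apply/rowP => -[].
have msh : measurable_fun setT (fun x : 'rV[R]_n.+1 => (x + v)%R).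
  apply/measurable_fun_rowP => i; under eq_fun do rewrite mxE.
  by apply: measurable_funD; [exact: measurable_coor|exact: measurable_cst].
have mB : measurable (@row_cons R n @^-1` A).
  by rewrite -[X in measurable X]setTI; exact: measurable_row_cons.
have mB' : measurable (@row_cons R n @^-1` ((fun x => (x + v)%R) @^-1` A)).
  rewrite -[X in measurable X]setTI; apply: measurable_row_cons => //.
  by rewrite -[X in measurable X]setTI; exact: msh.
rewrite /= /lebesgue_row_succ /pushforward /product_measure1.
set B := _ @^-1` A in mB *.
pose g x := lebesgue_row n (xsection B x).
have mg : measurable_fun setT g by exact: measurable_fun_xsection.
transitivity (\int[lebesgue_measure]_x g (x + v ord0 ord0)%R).
  apply: eq_integral => x _ /=; rewrite /g.
  rewrite -[RHS](IH (@rsubmx R 1 1 n v)); last exact: measurable_xsection.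
  congr (lebesgue_row n _); apply/seteqP; split=> y /=;
    by rewrite /xsection /= !inE /B /= row_consD.
have mshift : measurable_fun setT
    (fun x : measurableTypeR R => (x + v ord0 ord0)%R : measurableTypeR R).
  by apply: measurable_funD => //; exact: measurable_cst.
rewrite -[LHS]/(\int[lebesgue_measure]_(x in (fun x : measurableTypeR R =>
  (x + v ord0 ord0)%R : measurableTypeR R) @^-1` setT)
  (g \o (fun x : measurableTypeR R => (x + v ord0 ord0)%R)) x).
rewrite -ge0_integral_pushforward//.
by apply: eq_measure_integral => A' mA' _; exact: lebesgue_measure_shift.
Qed.

End lebesgue_translation.

(** * Measurability and integration on row vectors *)

Section row_measure.
Context {R : realType} {n : nat}.
Implicit Types (f g : 'rV[R]_n -> R) (x v : 'rV[R]_n).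
Local Notation mu := (@lebesgue_row R n).

(** The sigma-algebra is generated by the coordinates, so it contains the cubes with
    rational centres, which form a countable base of the topology. *)
Lemma open_measurable_row (A : set 'rV[R]_n) : open A -> measurable A.
Proof.
move=> oA.
pose box (q : 'rV[rat]_n * nat) : set 'rV[R]_n :=
  \bigcap_i [set x : 'rV[R]_n | `|x ord0 i - ratr (q.1 ord0 i)| < q.2.+1%:R^-1].
have mbox q : measurable (box q).
  apply: fin_bigcap_measurable => // i _.
  have := @measurable_coor R n i measurableT (ball (ratr (q.1 ord0 i) : R) q.2.+1%:R^-1).
  rewrite setTI => /(_ (measurable_ball _ _)); congr (measurable _).
  by apply/seteqP; split=> x /=; rewrite -ball_normE /ball_/= distrC.
rewrite (_ : A = \bigcup_q (if `[< box q `<=` A >] then box q else set0)).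
  apply: countable_bigcupT_measurable => // q.
  by case: ifP.
apply/seteqP; split=> [x Ax|x [q _]]; last first.
  by case: ifP => // /asboolP; exact.
have /nbhs_ballP[e /= e0 eA] : nbhs x A by exact: open_nbhs_nbhs.
have [k ke] : exists k : nat, 0 + k.+1%:R^-1 < e / 2.
  by apply: ltr_add_invr; rewrite divr_gt0.
rewrite add0r in ke.
have k0 : 0 < k.+1%:R^-1 :> R by rewrite invr_gt0.
have [q qP] : exists q : 'I_n -> rat, forall i,
    `|x ord0 i - ratr (q i)| < k.+1%:R^-1.
  apply: (@fin_all_exists _ (fun=> rat)
    (fun i q => `|x ord0 i - ratr q| < k.+1%:R^-1)) => i.
  have /rat_in_itvoo[q] : x ord0 i - k.+1%:R^-1 < x ord0 i + k.+1%:R^-1.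
    by rewrite ltrBlDr -addrA ltrDl addr_gt0.
  by rewrite in_itv/= => q1; exists q; rewrite distrC ltr_distl.
exists (\row_i q i, k) => //.
have -> : `[< box (\row_i q i, k) `<=` A >].
  apply/asboolP => y By; apply: eA; rewrite -ball_normE /ball_/=.
  apply: (@le_lt_trans _ _ (2 * k.+1%:R^-1)); last by rewrite mulrC -ltr_pdivlMr.
  apply: norm_le_coord => [|i]; first by rewrite mulr_ge0// ltW.
  have := By i Logic.I; rewrite /= mxE => B1.
  rewrite !mxE -(subrKA (ratr (q i))) (le_trans (ler_normD _ _))//.
  have := qP i; rewrite -[X in _ + X <= _]normrN opprB => B2; apply: ltW.
  by rewrite mulr2n mulrDl mul1r; exact: ltrD.
by move=> i _ /=; rewrite mxE.
Qed.

Lemma continuous_measurable_row f : continuous f -> measurable_fun setT f.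
Proof.
move=> cf; apply: (measurability _ (RGenOpens.measurableE R)).
move=> _ [_ [a [b ->] <-]]; rewrite setTI; apply: open_measurable_row.
by move/continuousP : cf; apply; exact: interval_open.
Qed.

Lemma norm_continuous_row : continuous (fun x : 'rV[R]_n => `|x|).
Proof. by move=> x; exact: norm_continuous. Qed.

Definition cube (M : R) : set 'rV[R]_n := [set x | `|x| <= M].

Lemma measurable_cube M : measurable (cube M).
Proof.
rewrite -[X in measurable X]setTI.
rewrite (_ : cube M = (fun x : 'rV[R]_n => `|x|) @^-1` `]-oo, M]%classic).
  exact: (continuous_measurable_row norm_continuous_row).
by apply/seteqP; split=> x /=; rewrite in_itv/=.
Qed.

End row_measure.

Section row_integral.
Context {R : realType}.
Import HBNNSimple.
Local Open Scope ereal_scope.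

Lemma lebesgue_cube_lty n (M : R) : lebesgue_row n (@cube R n M) < +oo.
Proof.
elim: n => [|n IH].
  rewrite /= /dirac/= indicE; exact: ltry.
rewrite /= /lebesgue_row_succ /pushforward.
have S : @row_cons R n @^-1` cube M `<=` `[(- M)%R, M]%classic `*` cube M.
  move=> [x y] /=; rewrite /cube/= => H; split=> /=.
    have := coord_le_norm (row_cons (x, y)) ord0.
    rewrite in_itv/= -ler_norml => /le_trans/(_ H); congr (`|_| <= _)%R.
    rewrite /row_cons /= -[LHS]/(@fun_of_matrix R 1 (1 + n) _ _ _).
    rewrite (_ : ord0 = lshift n ord0 :> 'I_(1 + n)); last exact: val_inj.
    by rewrite row_mxEl mxE.
  apply: norm_le_coord => [|i]; first exact: le_trans H.
  have := coord_le_norm (row_cons (x, y)) (rshift 1 i).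
  move=> /le_trans/(_ H); congr (`|_| <= _)%R.
  by rewrite /row_cons [LHS](row_mxEr _ _ ord0 i).
apply: (@le_lt_trans _ _ ((lebesgue_measure \x lebesgue_row n)
  (`[(- M)%R, M]%classic `*` @cube R n M))).
  apply: le_measure => //; rewrite inE; last first.
    by apply: measurableX; [exact: measurable_itv|exact: measurable_cube].
  rewrite -[X in measurable X]setTI; apply: measurable_row_cons => //.
  exact: measurable_cube.
rewrite product_measure1E//; last exact: measurable_cube.
apply: lte_mul_pinfty => //.
rewrite -[X in X \is a fin_num]/(lebesgue_measure `[(- M)%R, M]%classic).
by rewrite lebesgue_measure_itv/=; case: ifP => _ //; rewrite -EFinB.
Qed.

Lemma ge0_integral_shift n (v : 'rV[R]_n) (f : 'rV[R]_n -> \bar R) :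
  measurable_fun setT f -> (forall x, 0 <= f x) ->
  \int[lebesgue_row n]_x f (x + v)%R = \int[lebesgue_row n]_x f x.
Proof.
move=> mf f0.
have msh : measurable_fun setT (fun x : 'rV[R]_n => (x + v)%R).
  apply/measurable_fun_rowP => i; under eq_fun do rewrite mxE.
  by apply: measurable_funD; [exact: measurable_coor|exact: measurable_cst].
rewrite -[LHS]/(\int[lebesgue_row n]_(x in (fun x : 'rV[R]_n =>
  (x + v)%R) @^-1` setT) (f \o (fun x : 'rV[R]_n => (x + v)%R)) x).
rewrite -ge0_integral_pushforward//.
by apply: eq_measure_integral => A mA _; exact: lebesgue_row_shift.
Qed.

Lemma integral_shift n (v : 'rV[R]_n) (f : 'rV[R]_n -> \bar R) :
  measurable_fun setT f ->
  \int[lebesgue_row n]_x f (x + v)%R = \int[lebesgue_row n]_x f x.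
Proof.
move=> mf; rewrite integralE [RHS]integralE.
rewrite -[in RHS](ge0_integral_shift v (measurable_funepos mf))//.
rewrite -[in RHS](ge0_integral_shift v (measurable_funeneg mf))//.
by congr (_ - _); apply: eq_integral => x _; rewrite ?funeposE ?funenegE.
Qed.

Lemma Rintegral_shift n (v : 'rV[R]_n) (f : 'rV[R]_n -> R) :
  measurable_fun setT f ->
  (\int[lebesgue_row n]_x f (x + v) = \int[lebesgue_row n]_x f x)%R.
Proof.
move=> /measurable_EFinP mf; congr fine.
exact: (integral_shift v mf).
Qed.

Lemma integrable_bounded_support n (f : 'rV[R]_n -> R) (M C : R) :
  measurable_fun setT f -> (forall x, `|f x| <= C)%R ->
  (forall x, (M < `|x|)%R -> f x = 0%R) ->
  (lebesgue_row n).-integrable setT (EFin \o f).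
Proof.
move=> mf fC fM.
rewrite (_ : EFin \o f = (EFin \o f) \_ (@cube R n M)).
  apply/(integrable_mkcond _ (measurable_cube M)).
  apply: measurable_bounded_integrable.
  - exact: measurable_cube.
  - exact: lebesgue_cube_lty.
  - exact: measurable_funTS.
  by exists C; split; rewrite ?num_real// => r Cr x _ /=; apply: le_trans (ltW Cr).
apply/funext => x; rewrite /patch; case: ifPn => // /negP.
by rewrite inE /cube /= => /negP; rewrite -ltNge /= => /fM ->.
Qed.

(** The gradient of the distance takes arbitrary values on the null set where
    the distance is not differentiable, so expressions in it need not be
    measurable. Their integrals still ignore that set, because the simple
    functions below them can be cut off there. *)
Lemma integral_setD_null d (T : measurableType d)
    (mu : {measure set T -> \bar R}) (D N : set T) (f : T -> \bar R) :
  measurable N -> mu N = 0 ->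
  \int[mu]_(x in D) f x = \int[mu]_(x in D `\` N) f x.
Proof.
move=> mN N0.
have key (g : T -> \bar R) : (forall x, 0 <= g x) ->
    \int[mu]_(x in D) g x = \int[mu]_(x in D `\` N) g x.
  move=> g0; rewrite integral_mkcond [RHS]integral_mkcond.
  have gD0 A x : 0 <= (g \_ A) x by rewrite /patch; case: ifP.
  rewrite !ge0_integralTE//; apply/eqP; rewrite eq_le; apply/andP; split.
    apply: ge_ereal_sup => _ [h /= hg <-].
    apply: ereal_sup_ubound; exists (proj_nnsfun h (measurableC mN)) => [x|].
      rewrite -mrestrict /patch; have := hg x; rewrite /patch.
      by rewrite in_setD in_setC; case: (x \in D); case: (x \in N).
    rewrite -!integralT_nnsfun.
    rewrite (@ge0_negligible_integral _ _ _ mu setT N)//; last 2 first.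
      by apply/measurable_EFinP.
      by move=> x _; rewrite lee_fin.
    rewrite [RHS](@ge0_negligible_integral _ _ _ mu setT N)//; last 2 first.
      by apply/measurable_EFinP.
      by move=> x _; rewrite lee_fin.
    apply: eq_integral => x /set_mem [_ Nx].
    by rewrite -mrestrict /patch ifT// inE.
  apply: ereal_sup_le => _ [h /= hg <-]; exists h => // x.
  apply: (le_trans (hg x)); rewrite /patch; case: ifP => [/set_mem[Dx _]|_].
    by rewrite ifT// inE.
  by case: ifP.
by rewrite integralE [RHS]integralE !key.
Qed.

End row_integral.

Section measurable_row.
Context {R : realType} {n : nat}.
Local Notation mu := (@lebesgue_row R n).

Lemma continuous_comp_row_measurable (A : set 'rV[R]_n) (G : 'rV[R]_n -> R)
    (q : 'rV[R]_n -> 'rV[R]_n) : measurable A -> continuous G ->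
  (forall i, measurable_fun A (fun x => q x ord0 i)) ->
  measurable_fun A (fun x => G (q x)).
Proof.
move=> mA cG mq.
pose q' x := \row_i (((fun x => q x ord0 i) \_ A) x).
have mq' : measurable_fun setT q'.
  apply/measurable_fun_rowP => i; under eq_fun do rewrite mxE.
  exact: (measurable_restrictT _ mA).1 (mq i).
apply: (@eq_measurable_fun _ _ _ _ A (G \o q')).
  move=> x xA /=; congr G; apply/rowP => i; rewrite mxE /patch.
  by rewrite xA.
apply: measurable_funTS.
apply: (measurableT_comp (continuous_measurable_row cG) mq').
Qed.

Lemma measurable_derive_comp (A : set 'rV[R]_n) (f : 'rV[R]_n -> R)
    (q : 'rV[R]_n -> 'rV[R]_n) v : measurable A -> continuous f ->
  (forall i, measurable_fun A (fun x => q x ord0 i)) ->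
  (forall x, A x -> derivable f (q x) v) ->
  measurable_fun A (fun x => 'D_v f (q x)).
Proof.
move=> mA cf mq df.
apply: (@measurable_fun_cvg _ _ _ A
  (fun m x => m.+1%:R * (f (q x + m.+1%:R^-1 *: v) - f (q x)))) => [m|x Ax].
  apply: measurable_funM; first exact: measurable_cst.
  apply: measurable_funB; last exact: continuous_comp_row_measurable.
  apply: (@continuous_comp_row_measurable A (fun y => f (y + m.+1%:R^-1 *: v)) q) => //.
  move=> x.
  apply: (@continuous_comp _ _ _ (fun y => y + m.+1%:R^-1 *: v) f); last exact: cf.
  by apply: continuousD; [exact: cvg_id|exact: cst_continuous].
have /derivableP /is_derive_epsP H := df x Ax.
apply/cvgrPdist_le => e e0; have [r r0 rP] := H e e0.
near=> m.
have m0 : 0 < m.+1%:R^-1 :> R by rewrite invr_gt0.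
have mr : m.+1%:R^-1 < r.
  by near: m; have := @near_infty_natSinv_lt R (PosNum r0).
have := rP m.+1%:R^-1; rewrite gtr0_norm// => /(_ mr) Hm.
rewrite -(ler_pM2r m0); apply: le_trans Hm.
rewrite -[X in _ * X <= _](gtr0_norm m0) -normrM -normrN le_eqVlt.
apply/orP; left; apply/eqP; congr `|_|.
by field; rewrite addrC natr1 pnatr_eq0.
Unshelve. all: by end_near. Qed.

Lemma measurable_derive (A : set 'rV[R]_n) (f : 'rV[R]_n -> R) v :
  measurable A -> continuous f -> (forall x, A x -> derivable f x v) ->
  measurable_fun A (fun x => 'D_v f x).
Proof.
move=> mA cf df; apply: (@measurable_derive_comp A f id) => // i.
by apply: measurable_funTS; exact: measurable_coor.
Qed.

End measurable_row.

Section dominated.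
Context d (T : measurableType d) {R : realType}
  (mu : {measure set T -> \bar R}).

Lemma Rintegral_dominated_cvg (A : set T) (f_ : nat -> T -> R) (f g : T -> R) :
  measurable A ->
  (forall m, measurable_fun A (f_ m)) ->
  (forall x, A x -> f_ ^~ x @ \oo --> f x) ->
  mu.-integrable A (EFin \o g) ->
  (forall m x, A x -> `|f_ m x| <= g x) ->
  mu.-integrable A (EFin \o f) /\
  (fun m => \int[mu]_(x in A) f_ m x) @ \oo --> \int[mu]_(x in A) f x.
Proof.
move=> mA mf_ f_f ig fg.
have mf : measurable_fun A f by exact: measurable_fun_cvg f_f.
have [||||| i1 _ i2] := @dominated_convergence _ _ _ mu A mA
  (fun m => EFin \o f_ m) (EFin \o f) (EFin \o g).
- by move=> m; exact/measurable_EFinP.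
- exact/measurable_EFinP.
- apply: aeW => x Ax; apply: cvg_EFin; last exact: f_f.
  by apply: nearW.
- exact: ig.
- by apply: aeW => x m Ax; rewrite lee_fin; exact: fg.
split=> //; apply: fine_cvg.
rewrite fineK; first exact: i2.
exact: integrable_fin_num.
Qed.

Lemma Rintegral_sum (I : Type) (s : seq I) (f : I -> T -> R) (A : set T) :
  measurable A -> (forall i, mu.-integrable A (EFin \o f i)) ->
  mu.-integrable A (EFin \o (fun x => \sum_(i <- s) f i x)) /\
  \int[mu]_(x in A) (\sum_(i <- s) f i x) = \sum_(i <- s) \int[mu]_(x in A) f i x.
Proof.
move=> mA fi; elim: s => [|i s [IH1 IH2]].
  rewrite (_ : (fun x => \sum_(i <- [::]) f i x) = cst 0).
    by rewrite big_nil Rintegral_cst// mul0r; split=> //; exact: integrable0.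
  by apply/funext => x; rewrite big_nil.
rewrite (_ : (fun x => \sum_(j <- i :: s) f j x) =
    fun x => f i x + \sum_(j <- s) f j x); last first.
  by apply/funext => x; rewrite big_cons.
rewrite big_cons -IH2 -RintegralD//; split=> //.
exact: (integrableD mA (fi i) IH1).
Qed.

End dominated.

(** * Smooth functions with bounded support *)

Section bumps.
Context {R : realType} {n : nat}.
Implicit Types (f g k D : 'rV[R]_n -> R) (x y z v : 'rV[R]_n).
Local Notation mu := (@lebesgue_row R n).

Definition vanishes_outside (M : R) f := forall x, M < `|x| -> f x = 0.

Definition bumpf f := smooth f /\ exists M, vanishes_outside M f.

Lemma smooth_continuous f : smooth f -> continuous f.
Proof. by move=> /(_ 0%N) [H _] x; exact: H. Qed.

Lemma smooth_partial f i : smooth f -> smooth (partial i f).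
Proof. by move=> sf k; have [_ /(_ i) []] := sf k.+1. Qed.

Lemma smooth_derivable f x i : smooth f ->
  is_derive x (delta_mx ord0 i) f (partial i f x).
Proof.
by move=> /(_ 1%N) [_ /(_ i) [+ _]] => /(_ x Logic.I)/derivable_partial.
Qed.

Lemma smooth_is_derive f x v : smooth f ->
  is_derive x v f (dotp (gradient f x) v).
Proof.
move=> sf; apply: is_derive_C1 => i.
  apply: (@filterS _ _ (nbhs_filter x) setT); last exact: filterT.
  by move=> y _; have [] := smooth_derivable y i sf.
exact: (smooth_continuous (smooth_partial i sf)).
Qed.

Lemma vanishes_partial M f i :
  vanishes_outside M f -> vanishes_outside M (partial i f).
Proof.
move=> fM x Mx; rewrite /partial.
have oM : open [set y : 'rV[R]_n | M < `|y|].
  rewrite (_ : mkset _ = (fun y : 'rV[R]_n => `|y|) @^-1` `]M, +oo[%classic).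
    by move/continuousP : (@norm_continuous_row R n); apply; exact: interval_open.
  by apply/seteqP; split=> y /=; rewrite in_itv/= andbT.
rewrite (@near_eq_derive _ _ _ _ (cst 0)) ?derive_cst//.
have : \forall y \near x, [set y : 'rV[R]_n | M < `|y|] y by exact: open_nbhs_nbhs.
by apply: filterS => y /fM.
Qed.

Lemma bump_partial f i : bumpf f -> bumpf (partial i f).
Proof.
by move=> [sf [M fM]]; split; [exact: smooth_partial|exists M; exact: vanishes_partial].
Qed.

Lemma bumpM f g : smooth f -> bumpf g -> bumpf (fun x => f x * g x).
Proof.
move=> sf [sg [M gM]]; split; last by exists M => x /gM ->; rewrite mulr0.
by move=> k; apply: CkM; [exact: openT|exact: sf|exact: sg].
Qed.

Lemma smooth_cst (c : R) : smooth (fun _ : 'rV[R]_n => c).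
Proof. by move=> k; apply: Ck_cst; exact: openT. Qed.

Lemma continuous_locally_bounded f (M : R) : continuous f ->
  exists2 C : R, 0 <= C & forall x, `|x| <= M -> `|f x| <= C.
Proof.
move=> cf; have [M0|M0] := ltP M 0.
  by exists 0 => // x /le_lt_trans/(_ M0); rewrite normr_lt0.
have cc : compact (@cube R n M).
  apply: bounded_closed_compact.
    by exists M; split; rewrite ?num_real// => r Mr x /= xM; exact: le_trans (ltW Mr).
  apply: (@preimage_closed _ _ (fun x : 'rV[R]_n => `|x|) [set r | r <= M]).
    by move=> x _; exact: norm_continuous.
  exact: closed_le.
have [||x _ xmax] := @EVT_max_rV R n (fun x => `|f x|) (cube M) _ cc.
- by exists 0; rewrite /cube /= normr0.
- apply: continuous_subspaceT => x.
  apply: (@continuous_comp _ _ _ f (fun r : R => `|r|)); first exact: cf.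
  exact: norm_continuous.
exists `|f x| => // y yM; apply: xmax; exact: mem_set.
Qed.

Lemma bump_bounded f : bumpf f ->
  exists2 C : R, 0 <= C & forall x, `|f x| <= C.
Proof.
move=> [sf [M fM]].
have [C C0 CP] := continuous_locally_bounded M (smooth_continuous sf).
exists C => // x; have [/CP//|/fM ->] := leP `|x| M; by rewrite normr0.
Qed.

Lemma bump_lipschitz f : bumpf f ->
  exists2 C : R, 0 <= C & forall x y, `|f x - f y| <= C * `|x - y|.
Proof.
move=> bf.
have [C CP] : exists C : 'I_n -> R, forall i, 0 <= C i /\
    forall x, `|partial i f x| <= C i.
  apply: (@fin_all_exists _ (fun=> R) (fun i C => 0 <= C /\
    forall x, `|partial i f x| <= C)) => i.
  by have [C C0 CP] := bump_bounded (bump_partial i bf); exists C.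
exists (\sum_i C i) => [|x y]; first by apply: sumr_ge0 => i _; have [] := CP i.
have [|s _] := @mvt_segment _ _ f y (x - y).
  by move=> s _; have [] := smooth_is_derive (y + s *: (x - y)) (x - y) bf.1.
have [_ ->] := smooth_is_derive (y + s *: (x - y)) (x - y) bf.1.
rewrite [X in f X - _](_ : _ = x); last by rewrite addrC subrK.
move=> ->; rewrite dotp_gradient mulr_suml.
apply: (le_trans (ler_norm_sum _ _ _)); apply: ler_sum => i _.
rewrite normrM mulrC ler_pM ?coord_le_norm//.
by have [_] := CP i; exact.
Qed.

Lemma bump_integrable f : bumpf f -> mu.-integrable setT (EFin \o f).
Proof.
move=> bf; have [C C0 CP] := bump_bounded bf; have [sf [M fM]] := bf.
apply: (@integrable_bounded_support _ _ _ M C) => //.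
by apply: continuous_measurable_row; exact: smooth_continuous.
Qed.

Lemma continuous_mul_bump_integrable D k : continuous D -> bumpf k ->
  mu.-integrable setT (EFin \o (fun x => D x * k x)).
Proof.
move=> cD bk; have [C C0 CP] := bump_bounded bk; have [sk [M kM]] := bk.
have [C' C'0 C'P] := continuous_locally_bounded M cD.
apply: (@integrable_bounded_support _ _ _ M (C' * C)) => //.
- apply: measurable_funM; first exact: continuous_measurable_row.
  by apply: continuous_measurable_row; exact: smooth_continuous.
- move=> x; have [xM|/kM ->] := leP `|x| M; last by rewrite mulr0 normr0 mulr_ge0.
  by rewrite normrM ler_pM// C'P.
- by move=> x /kM ->; rewrite mulr0.
Qed.

Lemma is_derive_shift_arg f x v z (d : R) :
  is_derive (x + z) v f d -> is_derive x v (fun y => f (y + z)) d.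
Proof.
move=> /is_derive_epsP H; apply/is_derive_epsP => e /H[r r0 rP].
by exists r => // h /rP; rewrite (addrAC x z).
Qed.

Lemma bump_shift k z : bumpf k -> bumpf (fun y => k (y + z)).
Proof.
move=> [sk [M kM]]; split; last first.
  exists (M + `|z|) => x; rewrite -ltrBrDr => H; apply: kM.
  apply: (lt_le_trans H); rewrite lerBlDr -{1}(addrK z x).
  by rewrite (le_trans (ler_normB _ _)).
move=> r; elim: r k sk {kM} => [|r IH] k sk.
  split=> // x _; apply: (@continuous_comp _ _ _ (fun y => y + z) k).
    by apply: continuousD; [exact: cvg_id|exact: cst_continuous].
  exact: smooth_continuous.
have D x i : is_derive x (delta_mx ord0 i) (fun y => k (y + z))
    (partial i k (x + z)).
  exact/is_derive_shift_arg/smooth_derivable.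
split=> [x _|i].
  apply: (@continuous_comp _ _ _ (fun y => y + z) k).
    by apply: continuousD; [exact: cvg_id|exact: cst_continuous].
  exact: smooth_continuous.
split=> [x _|]; first by have [] := D x i.
have -> : partial i (fun y => k (y + z)) = (fun y => partial i k (y + z)).
  by apply/funext => x; have [_] := D x i.
exact/IH/smooth_partial.
Qed.

End bumps.

(** * Correlation with a smooth kernel *)

Section correlation.
Context {R : realType} {n : nat}.
Implicit Types (f g k D : 'rV[R]_n -> R) (x y z v : 'rV[R]_n).
Local Notation mu := (@lebesgue_row R n).

(** Up to reflections this is a convolution; in this form differentiation in [z]
    produces no signs. *)
Definition correlation D k z : R := \int[mu]_y (D y * k (y + z)).

Let e_ i : 'rV[R]_n := delta_mx ord0 i.

Let big_indic (M C : R) x : R := C * \1_(@cube R n M) x.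

Let big_indic_integrable M C : 0 <= C ->
  mu.-integrable setT (EFin \o big_indic M C).
Proof.
move=> C0; apply: (@integrable_bounded_support _ _ _ M C).
- apply: measurable_funM; first exact: measurable_cst.
  by apply: measurable_indic; exact: measurable_cube.
- move=> x; rewrite /big_indic indicE; case: (_ \in _).
    by rewrite mulr1 ger0_norm.
  by rewrite mulr0 normr0.
- move=> x xM; rewrite /big_indic indicE memNset ?mulr0//.
  by rewrite /cube /=; apply/negP; rewrite -ltNge.
Qed.

Lemma correlation_integrable D k z : continuous D -> bumpf k ->
  mu.-integrable setT (EFin \o (fun y => D y * k (y + z))).
Proof. by move=> cD bk; apply: continuous_mul_bump_integrable => //; exact: bump_shift. Qed.

(** The derivative falls on the smooth factor; it is dominated on the bounded
    set where that factor can be nonzero. *)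
Lemma is_derive_correlation D k z i : continuous D -> bumpf k ->
  is_derive z (e_ i) (correlation D k) (correlation D (partial i k) z).
Proof.
move=> cD bk; have [sk [M kM]] := bk.
have [C C0 CP] := bump_bounded (bump_partial i bk).
have [C' C'0 C'P] := continuous_locally_bounded (M + `|z| + 1) cD.
pose f (t : R) y := D y * k (y + (z + t *: e_ i)).
have Df (t : R) y : is_derive t 1 (f ^~ y) (D y * partial i k (y + (z + t *: e_ i))).
  apply: is_deriveZ; under eq_fun do rewrite addrA.
  by rewrite addrA; apply/is_derive_line; exact: smooth_derivable.
have intf (t : R) : (`]-1, 1[%classic : set R) t -> mu.-integrable setT (EFin \o f t).
  by move=> _; exact: correlation_integrable.
have derf (t : R) y : (`]-1, 1[%classic : set R) t -> [set: 'rV[R]_n] y ->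
    derivable (f ^~ y) t 1 by move=> _ _; have [] := Df t y.
have I0 : (`]-1, 1[%classic : set R) 0 by rewrite /= in_itv/= ltrN10 ltr01.
have G0 y : 0 <= big_indic (M + `|z| + 1) (C' * C) y.
  by rewrite /big_indic indicE !mulr_ge0.
have GP (t : R) y : (`]-1, 1[%classic : set R) t -> [set: 'rV[R]_n] y ->
    `|partial1of2 f t y| <= big_indic (M + `|z| + 1) (C' * C) y.
  rewrite /= in_itv/= => /andP[t1 t2] _; rewrite partial1of2E.
  have [_ ->] := Df t y; rewrite /big_indic indicE.
  have [yM|yM] := boolP (y \in cube _).
    by rewrite mulr1 normrM ler_pM// C'P//; move/set_mem : yM.
  rewrite (vanishes_partial i kM) ?mulr0 ?normr0//.
  move: yM; rewrite notin_setE /cube /= => /negP; rewrite -ltNge => yM.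
  have te : `|t *: e_ i| <= 1.
    by rewrite normrZ mulr_ile1 ?norm_delta_mx_le1// ler_norml !ltW.
  have : `|y| <= `|y + (z + t *: e_ i)| + (`|z| + `|t *: e_ i|).
    rewrite -{1}(addrK (z + t *: e_ i) y) (le_trans (ler_normB _ _))//.
    by rewrite lerD2l ler_normD.
  lra.
have iG := @big_indic_integrable (M + `|z| + 1) _ (mulr_ge0 C'0 C0).
have D1 := @derivable_under_integral R _ _ mu f setT measurableT 0 (-1) 1 I0 intf derf
  _ G0 iG GP.
have D2 := @differentiation_under_integral R _ _ mu f setT measurableT 0 (-1) 1 I0 intf derf
  _ G0 iG GP.
rewrite -[z]addr0 -[X in z + X](scale0r (e_ i)); apply/is_derive_line.
apply: DeriveDef => //; rewrite -derive1E D2 scale0r addr0.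
apply: eq_Rintegral => y _; rewrite partial1of2E.
by have [_ ->] := Df 0 y; rewrite scale0r addr0.
Qed.

Lemma correlation_continuous D k : continuous D -> bumpf k ->
  continuous (correlation D k).
Proof.
move=> cD bk z; have [sk [M kM]] := bk.
have [L L0 LP] := bump_lipschitz bk.
have [C C0 CP] := continuous_locally_bounded (M + `|z| + 1) cD.
pose A := \int[mu]_y big_indic (M + `|z| + 1) (C * L) y.
have A0 : 0 <= A.
  by apply: Rintegral_ge0 => y _; rewrite /big_indic indicE !mulr_ge0.
apply/(@cvgrPdist_le _ _ _ (nbhs z) (nbhs_filter z)) => e e0.
have A1 : 0 < A + 1 by rewrite ltr_wpDl.
have r0 : 0 < Num.min 1 (e / (A + 1)) by rewrite lt_min ltr01 divr_gt0.
apply: filterS (nbhsx_ballx z _ r0) => z'; rewrite -ball_normE /ball_/=.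
rewrite lt_min => /andP[zz1 zze].
have I1 := correlation_integrable z cD bk.
have I2 := correlation_integrable z' cD bk.
rewrite /correlation -RintegralB//.
have IB : mu.-integrable setT
    (EFin \o (fun y => D y * k (y + z) - D y * k (y + z'))).
  by apply: (integrableB _ I1 I2).
apply: (le_trans (le_normr_Rintegral _ IB)) => //.
apply: (@le_trans _ _ (\int[mu]_y (`|z - z'| * big_indic (M + `|z| + 1) (C * L) y))).
  apply: le_Rintegral => //.
  - exact: integrable_norm.
  - exact: (integrableZl measurableT `|z - z'|
      (big_indic_integrable (M + `|z| + 1) (mulr_ge0 C0 L0))).
  move=> y _; rewrite -mulrBr normrM /big_indic indicE.
  have [yM|yM] := boolP (y \in cube _).
    rewrite mulr1 mulrCA ler_pM//; first by apply: CP; move/set_mem : yM.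
    apply: (le_trans (LP _ _)); rewrite mulrC.
    by rewrite opprD addrACA subrr add0r.
  move: yM; rewrite notin_setE /cube /= => /negP; rewrite -ltNge => yM.
  have z'n : `|z'| <= `|z| + 1.
    by rewrite -[z'](subKr z) (le_trans (ler_normB _ _))// lerD2l ltW.
  have H w : `|y| <= `|y + w| + `|w|.
    by rewrite -{1}(addrK w y) (le_trans (ler_normB _ _)).
  rewrite !kM ?subrr ?normr0 ?mulr0//; [have := H z'; lra|have := H z; lra].
rewrite RintegralZl//; last by apply: big_indic_integrable; rewrite mulr_ge0.
rewrite -/A; apply: (@le_trans _ _ (e / (A + 1) * A)).
  by rewrite ler_wpM2r// ltW.
rewrite mulrAC ler_pdivrMr// ler_pM2l// lerDl.
by [].
Qed.

Lemma correlation_smooth D k : continuous D -> bumpf k -> smooth (correlation D k).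
Proof.
move=> cD + r; elim: r k => [|r IH] k bk.
  by split=> // x _; exact: correlation_continuous.
split=> [x _|i]; first exact: correlation_continuous.
split=> [x _|]; first by have [] := is_derive_correlation x i cD bk.
have -> : partial i (correlation D k) = correlation D (partial i k).
  by apply/funext => x; have [_] := is_derive_correlation x i cD bk.
exact/IH/bump_partial.
Qed.

(** The correlation with the constant 1 is constant by translation invariance, so
    its derivative vanishes. *)
Lemma Rintegral_partial k i : bumpf k -> \int[mu]_y partial i k y = 0.
Proof.
move=> bk.
have c1 : continuous (fun _ : 'rV[R]_n => 1 : R) by move=> x; exact: cst_continuous.
have E l : bumpf l -> correlation (fun=> 1) l = cst (\int[mu]_y l y).
  move=> bl; apply/funext => z; rewrite /correlation /=.
  under eq_Rintegral do rewrite mul1r.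
  apply: Rintegral_shift; apply: continuous_measurable_row.
  exact: smooth_continuous bl.1.
have [_] := is_derive_correlation 0 i c1 bk.
by rewrite E// derive_cst E//; exact: bump_partial.
Qed.

Lemma is_derive_coord (j i : 'I_n) x :
  is_derive x (e_ i) (fun y : 'rV[R]_n => y ord0 j) (i == j)%:R.
Proof.
apply/is_derive_epsP => e e0; exists 1 => // h _.
rewrite !mxE eqxx/= (eq_sym j) addrAC addrK subrr normr0.
by rewrite mulr_ge0// ltW.
Qed.

Lemma smooth_coord (j : 'I_n) : smooth (fun y : 'rV[R]_n => y ord0 j).
Proof.
have cc : continuous (fun y : 'rV[R]_n => y ord0 j) by exact: coord_continuous.
case=> [|r]; first by split=> // x _; exact: cc.
split=> [x _|i]; first exact: cc.
split=> [x _|]; first by have [] := is_derive_coord j i x.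
have -> : partial i (fun y : 'rV[R]_n => y ord0 j) = fun=> (i == j)%:R.
  by apply/funext => x; have [_] := is_derive_coord j i x.
exact: smooth_cst.
Qed.

(** Integration by parts, obtained from the vanishing of the integral of the
    derivative of a product. *)
Lemma Rintegral_coord_partial k i j : bumpf k ->
  \int[mu]_y (y ord0 j * partial i k y) = - (i == j)%:R * \int[mu]_y k y.
Proof.
move=> bk; have sc := smooth_coord j.
have bp := bumpM sc bk.
have := Rintegral_partial i bp.
have E y : partial i (fun y : 'rV[R]_n => y ord0 j * k y) y =
    (i == j)%:R * k y + y ord0 j * partial i k y.
  have [_ H] := is_deriveM (is_derive_coord j i y) (smooth_derivable y i bk.1).
  transitivity (y ord0 j * partial i k y + k y * (i == j)%:R); first exact: H.
  by rewrite addrC [k y * _]mulrC.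
under eq_Rintegral do rewrite E.
rewrite RintegralD//; last 2 first.
- by apply: (integrableZl _ _ (bump_integrable bk)).
- exact: (bump_integrable (bumpM sc (bump_partial i bk))).
rewrite RintegralZl//; last exact: bump_integrable.
by move/eqP; rewrite addrC addr_eq0 mulNr => /eqP.
Qed.

End correlation.

(** * Mollification of a Lipschitz function *)

Section mollification.
Context {R : realType} {n : nat}.
Local Notation mu := (@lebesgue_row R n).
Variables (d k : 'rV[R]_n -> R) (C : R).
Hypothesis C0 : 0 <= C.
Hypothesis dC : forall x y, `|d x - d y| <= C * `|x - y|.
Hypothesis bk : bumpf k.
Hypothesis k0 : forall y, 0 <= k y.
Hypothesis k1 : \int[mu]_y k y = 1.
Implicit Types (x y p v : 'rV[R]_n) (e : R).

(** The dilation is applied to the argument of [d] rather than to the kernel;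
    then translations are the only changes of variables that occur. *)
Definition mollify e x : R := \int[mu]_y (d (x - e *: y) * k y).

Let cts_line e x : continuous (fun y => d (x - e *: y)).
Proof.
apply: (@lipschitz_cts _ _ _ (C * `|e|)) => y z; apply: (le_trans (dC _ _)).
rewrite (_ : x - e *: y - (x - e *: z) = - (e *: (y - z))).
  by rewrite normrN normrZ mulrA.
by apply/rowP => i; rewrite !mxE; ring.
Qed.

Let cts_dil e : continuous (fun y => d (- e *: y)).
Proof.
by have := @cts_line e 0; under eq_fun do rewrite sub0r -scaleNr.
Qed.

Let correlation_dil e x (l : 'rV[R]_n -> R) : e != 0 -> bumpf l ->
  correlation (fun y => d (- e *: y)) l (e^-1 *: x) =
  \int[mu]_y (d (x - e *: y) * l y).
Proof.
move=> e0 bl.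
rewrite -(@Rintegral_shift _ _ (e^-1 *: x) (fun y => d (x - e *: y) * l y)).
  apply: eq_Rintegral => y _; congr (d _ * _).
  by rewrite scalerDr scalerA divff// scale1r opprD addrCA subrr addr0 scaleNr.
apply: measurable_funM; first exact: continuous_measurable_row.
by apply: continuous_measurable_row; exact: smooth_continuous bl.1.
Qed.

Let mollifyE e : e != 0 ->
  mollify e = fun x => correlation (fun y => d (- e *: y)) k (e^-1 *: x).
Proof. by move=> e0; apply/funext => x; rewrite correlation_dil. Qed.

Lemma mollify_smooth e : e != 0 -> smooth (mollify e).
Proof.
by move=> e0 r; rewrite mollifyE//; apply: Ck_scale; exact: correlation_smooth.
Qed.

Let quotient e i x y := e^-1 * (d (x - e *: y) - d x) * partial i k y.

Let quotient_integrable e i x : mu.-integrable setT (EFin \o quotient e i x).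
Proof.
apply: continuous_mul_bump_integrable; last exact: bump_partial.
move=> y; exact: (cvgM (cvg_cst e^-1) (cvgB (@cts_line e x y) (cvg_cst (d x)))).
Qed.

(** The value [d x] can be subtracted under the integral because the derivative of
    the kernel has integral 0. The quotients that appear are bounded by the
    Lipschitz constant. *)
Lemma partial_mollify e i x : e != 0 ->
  partial i (mollify e) x = \int[mu]_y quotient e i x y.
Proof.
move=> e0; have bp := bump_partial i bk.
have D := is_derive_scale (is_derive_correlation (e^-1 *: x) i (@cts_dil e) bk).
rewrite mollifyE//; have [_ E] := D; rewrite [LHS]E (correlation_dil x e0 bp).
have I0 := continuous_mul_bump_integrable (@cts_line e x) bp.
rewrite -RintegralZl//.
have -> : \int[mu]_y quotient e i x y =
    \int[mu]_y (e^-1 * (d (x - e *: y) * partial i k y) -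
                e^-1 * d x * partial i k y).
  by apply: eq_Rintegral => y _; rewrite /quotient; ring.
have I1 : mu.-integrable setT (EFin \o (fun y => e^-1 * (d (x - e *: y) * partial i k y))).
  exact: (integrableZl measurableT e^-1 I0).
have I2 : mu.-integrable setT (EFin \o (fun y => e^-1 * d x * partial i k y)).
  exact: (integrableZl measurableT (e^-1 * d x) (bump_integrable bp)).
rewrite RintegralB// [X in _ - X]RintegralZl//; last exact: bump_integrable.
by rewrite Rintegral_partial// mulr0 subr0.
Qed.

Let bound i y := C * `|y| * `|partial i k y|.

Let norm_cts : continuous (fun y : 'rV[R]_n => `|y|) := @norm_continuous_row R n.

Let bound_integrable i : mu.-integrable setT (EFin \o bound i).
Proof.
have := integrable_norm (continuous_mul_bump_integrable norm_cts (bump_partial i bk)).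
move=> /(integrableZl measurableT C); apply: eq_integrable => // y _.
by rewrite /bound /= -EFinM normrM normr_id mulrA.
Qed.

Let quotient_le e i x y : 0 < e -> `|quotient e i x y| <= bound i y.
Proof.
move=> e0; rewrite /quotient /bound normrM ler_wpM2r//.
rewrite normrM normfV (gtr0_norm e0)// ler_pdivrMl//.
apply: (le_trans (dC _ _)); rewrite addrAC subrr add0r normrN normrZ (gtr0_norm e0).
by rewrite mulrCA.
Qed.

Lemma partial_mollify_le : exists2 B : R, 0 <= B &
  forall e i x, 0 < e -> `|partial i (mollify e) x| <= B.
Proof.
exists (\sum_i \int[mu]_y bound i y) => [|e i x e0].
  by apply: sumr_ge0 => i _; apply: Rintegral_ge0 => y _; rewrite /bound !mulr_ge0.
rewrite partial_mollify ?gt_eqF//.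
apply: (@le_trans _ _ (\int[mu]_y bound i y)); last first.
  rewrite (bigD1 i)//= lerDl; apply: sumr_ge0 => j _.
  by apply: Rintegral_ge0 => y _; rewrite /bound !mulr_ge0.
apply: (le_trans (le_normr_Rintegral measurableT (quotient_integrable e i x))).
apply: le_Rintegral => //; first exact: integrable_norm.
by move=> y _; exact: quotient_le.
Qed.

(** At a point of differentiability the difference quotients converge to a
    linear function, whose integral against a partial derivative of the kernel is
    found by parts. *)
Lemma partial_mollify_cvg x p i :
  (forall v, is_derive x v d (dotp p v)) ->
  (fun m : nat => partial i (mollify m.+1%:R^-1) x) @ \oo --> p ord0 i.
Proof.
move=> dx.
have e0 m : 0 < m.+1%:R^-1 :> R by rewrite invr_gt0.
have -> : (fun m : nat => partial i (mollify m.+1%:R^-1) x) =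
    fun m => \int[mu]_y quotient m.+1%:R^-1 i x y.
  by apply/funext => m; rewrite partial_mollify// gt_eqF.
have lim y : (fun m => quotient m.+1%:R^-1 i x y) @ \oo -->
    - dotp p y * partial i k y.
  apply: cvgM; last exact: cvg_cst.
  have /is_derive_epsP H := dx (- y).
  apply/cvgrPdist_le => e epos; have [r r0 rP] := H e epos.
  near=> m.
  have := rP m.+1%:R^-1; rewrite gtr0_norm// => /(_ _).
  have mr : m.+1%:R^-1 < r.
    by near: m; have := @near_infty_natSinv_lt R (PosNum r0).
  move=> /(_ mr); rewrite dotpNr scalerN => Hm.
  rewrite -(ler_pM2r (e0 m)); apply: le_trans Hm.
  rewrite -[X in _ * X <= _](gtr0_norm (e0 m)) -normrM -normrN.
  rewrite le_eqVlt; apply/orP; left; apply/eqP; congr `|_|.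
  rewrite !mulrBl [_ * _ * m.+1%:R^-1]mulrAC mulVf ?gt_eqF//; ring.
have mq m : measurable_fun setT (quotient m.+1%:R^-1 i x).
  by have /integrableP[/measurable_EFinP] := quotient_integrable m.+1%:R^-1 i x.
have [_] := @Rintegral_dominated_cvg _ _ _ mu setT
  (fun m => quotient m.+1%:R^-1 i x) (fun y => - dotp p y * partial i k y)
  (bound i) measurableT mq (fun y _ => lim y)
  (bound_integrable i) (fun m y _ => quotient_le i x y (e0 m)).
congr (_ --> _).
have Ic j : mu.-integrable setT (EFin \o (fun y => y ord0 j * partial i k y)).
  exact: (bump_integrable (bumpM (smooth_coord j) (bump_partial i bk))).
have Ij j : mu.-integrable setT
    (EFin \o (fun y => - p ord0 j * (y ord0 j * partial i k y))).
  exact: (integrableZl measurableT (- p ord0 j) (Ic j)).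
have -> : \int[mu]_y (- dotp p y * partial i k y) =
    \int[mu]_y \sum_j - p ord0 j * (y ord0 j * partial i k y).
  apply: eq_Rintegral => y _; rewrite /dotp -sumrN mulr_suml.
  by apply: eq_bigr => j _; rewrite !mulNr mulrA.
rewrite (Rintegral_sum _ measurableT Ij).2 (bigD1 i)//= big1 => [|j ji].
  by rewrite addr0 RintegralZl// Rintegral_coord_partial// eqxx k1 mulr1 mulrNN mulr1.
by rewrite RintegralZl// Rintegral_coord_partial// eq_sym (negPf ji) oppr0 mul0r mulr0.
Unshelve. all: by end_near. Qed.

Lemma mollify_ge0 e x : (forall x, 0 <= d x) -> 0 <= mollify e x.
Proof. by move=> d0; apply: Rintegral_ge0 => y _; rewrite mulr_ge0. Qed.

Lemma mollify_cvg x :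
  (fun m : nat => mollify m.+1%:R^-1 x) @ \oo --> d x.
Proof.
pose g y := C * `|y| * k y.
have ig : mu.-integrable setT (EFin \o g).
  have := continuous_mul_bump_integrable norm_cts bk.
  move=> /(integrableZl measurableT C); apply: eq_integrable => // y _.
  by rewrite /g /= -EFinM mulrA.
have ic e : mu.-integrable setT (EFin \o (fun y => d (x - e *: y) * k y)).
  exact: continuous_mul_bump_integrable (@cts_line e x) bk.
have id : mu.-integrable setT (EFin \o (fun y => d x * k y)).
  exact: (integrableZl measurableT (d x) (bump_integrable bk)).
have close e : 0 < e -> `|d x - mollify e x| <= e * \int[mu]_y g y.
  move=> e0; have -> : d x = \int[mu]_y (d x * k y).
    by rewrite RintegralZl//; [rewrite k1 mulr1|exact: bump_integrable].
  have ib : mu.-integrable setT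
      (EFin \o (fun y => d x * k y - d (x - e *: y) * k y)).
    exact: (integrableB measurableT id (ic e)).
  rewrite /mollify -RintegralB// -RintegralZl//.
  apply: (le_trans (le_normr_Rintegral measurableT ib)).
  apply: le_Rintegral => //; [exact: integrable_norm|exact: (integrableZl measurableT e ig)|].
  move=> y _; rewrite -mulrBl normrM [`|k y|]ger0_norm// /g mulrA ler_wpM2r//.
  apply: (le_trans (dC _ _)); rewrite opprB addrC subrK normrZ (gtr0_norm e0).
  by rewrite mulrCA.
apply/cvgrPdist_le => e e0.
have G0 : 0 <= \int[mu]_y g y.
  by apply: Rintegral_ge0 => y _; rewrite /g !mulr_ge0.
have r0 : 0 < e / (\int[mu]_y g y + 1) by rewrite divr_gt0// ltr_wpDl.
near=> m.
apply: (le_trans (close _ _)); first by rewrite invr_gt0.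
have mr : m.+1%:R^-1 < e / (\int[mu]_y g y + 1).
  by near: m; have := @near_infty_natSinv_lt R (PosNum r0).
apply: (@le_trans _ _ (e / (\int[mu]_y g y + 1) * \int[mu]_y g y)).
  by rewrite ler_wpM2r// ltW.
by rewrite mulrAC ler_pdivrMr ?ltr_wpDl// ler_pM2l// lerDl.
Unshelve. all: by end_near. Qed.

End mollification.

(** * Convex functions are differentiable almost everywhere *)

Section convex_ae.
Context {R : realType} {n : nat}.
Local Notation mu := (@lebesgue_row R n).
Variable f : 'rV[R]_n -> R.
Hypothesis fconvex : forall (x y : 'rV[R]_n) (t : R), 0 <= t <= 1 ->
  f (t *: x + (1 - t) *: y) <= t * f x + (1 - t) * f y.
Hypothesis fcts : continuous f.
Implicit Types (x y v : 'rV[R]_n).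

Let S (t : R) v x := f (x + t *: v) + f (x - t *: v) - 2 * f x.

Let S_ge0 t v x : 0 <= S t v x.
Proof.
have := @fconvex (x + t *: v) (x - t *: v) 2^-1.
have -> : 2^-1 *: (x + t *: v) + (1 - 2^-1) *: (x - t *: v) = x.
  by apply/rowP => i; rewrite !mxE; field.
rewrite /S => H; have : f x <= 2^-1 * f (x + t *: v) + (1 - 2^-1) * f (x - t *: v).
  by apply: H; lra.
lra.
Qed.

Let slope_le x v (a b : R) : 0 < a -> a <= b ->
  f (x + a *: v) - f x <= a / b * (f (x + b *: v) - f x).
Proof.
move=> a0 ab; have b0 : 0 < b by exact: lt_le_trans ab.
have ab1 : 0 <= a / b <= 1.
  by rewrite divr_ge0 ?(ltW a0) ?(ltW b0)//= ler_pdivrMr// mul1r.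
have := fconvex (x + b *: v) x ab1.
have -> : a / b *: (x + b *: v) + (1 - a / b) *: x = x + a *: v.
  by apply/rowP => i; rewrite !mxE; field; rewrite gt_eqF.
lra.
Qed.

(** For a convex function the two one-sided derivatives along a line agree as
    soon as the second difference quotients are small at arbitrarily small
    scales: they squeeze all the difference quotients. *)
Lemma convex_derivable x v :
  (forall e : R, 0 < e -> exists2 t : R, 0 < t & S t v x <= e * t) ->
  derivable f x v.
Proof.
move=> HS.
pose s (t : R) := f (x + t *: v) - f x.
have s_le a b : 0 < a -> a <= b -> s a <= a / b * s b.
  by move=> a0 ab; exact: slope_le.
have sN_le a b : 0 < a -> a <= b -> s (- a) <= a / b * s (- b).
  by move=> a0 ab; have := slope_le x (- v) a0 ab; rewrite !scalerN -!scaleNr.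
have s_mix (a b : R) : 0 < a -> 0 < b -> 0 <= b * s a + a * s (- b).
  move=> a0 b0; have ab0 : 0 < a + b by rewrite addr_gt0.
  have ab1 : 0 <= b / (a + b) <= 1.
    by rewrite divr_ge0 ?(ltW b0) ?(ltW ab0)//= ler_pdivrMr// mul1r lerDr ltW.
  have := fconvex (x + a *: v) (x + - b *: v) ab1.
  have -> : b / (a + b) *: (x + a *: v) + (1 - b / (a + b)) *: (x + - b *: v) = x.
    by apply/rowP => i; rewrite !mxE; field; rewrite gt_eqF.
  rewrite -(ler_pM2l ab0) mulrDr !mulrA [(a + b) * b / _]mulrAC divff ?gt_eqF//.
  rewrite (_ : (a + b) * (1 - b / (a + b)) = a); last by field; rewrite gt_eqF.
  by rewrite /s; lra.
pose Q := [set s t / t | t in [set t : R | 0 < t]].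
have Qlb b : 0 < b -> lbound Q (- s (- b) / b).
  move=> b0 _ [a /= a0 <-]; rewrite ler_pdivlMr// mulrAC ler_pdivrMr//.
  by have := s_mix a b a0 b0; lra.
have Qne : Q !=set0 by exists (s 1 / 1); exists 1 => //=.
have Ds b : 0 < b -> inf Q <= s b / b.
  by move=> b0; apply: ge_inf; [exists (- s (- 1) / 1); exact: Qlb|exists b].
have sD b : 0 < b -> - s (- b) / b <= inf Q.
  by move=> b0; apply: lb_le_inf => //; exact: Qlb.
suff : is_derive x v f (inf Q) by case.
apply/is_derive_epsP => e /HS[t t0 St].
have {}St : s t / t + s (- t) / t <= e.
  by rewrite -mulrDl ler_pdivrMr//; move: St; rewrite /S /s scaleNr; lra.
have key b : 0 < b -> b < t ->
    `|s b - b * inf Q| <= e * b /\ `|s (- b) + b * inf Q| <= e * b.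
  move=> b0 bt.
  have h1 := Ds b b0; have h2 := sD b b0.
  have h3 := Ds t t0; have h4 := sD t t0.
  have h5 := s_le b t b0 (ltW bt); have h6 := sN_le b t b0 (ltW bt).
  rewrite ler_pdivlMr// in h1; rewrite ler_pdivrMr// in h2.
  rewrite mulrAC -mulrA [b * _]mulrC in h5.
  rewrite mulrAC -mulrA [b * _]mulrC in h6.
  have k1 : s t / t * b <= (inf Q + e) * b.
    by rewrite ler_pM2r//; lra.
  have k2 : s (- t) / t * b <= (- inf Q + e) * b.
    by rewrite ler_pM2r//; lra.
  by rewrite !ler_norml; split; lra.
exists t => // h ht; rewrite -/(s h).
have [h0|h0|<-] := ltgtP 0 h.
- by rewrite gtr0_norm// in ht *; have [] := key h h0 ht.
- rewrite ltr0_norm// in ht *; have nh0 : 0 < - h by rewrite oppr_gt0.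
  by have [_] := key (- h) nh0 ht; rewrite opprK mulNr.
- by rewrite /s scale0r addr0 mul0r normr0 mulr0 subr0 subrr normr0.
Qed.

Variable phi : 'rV[R]_n -> R.
Hypothesis bphi : bumpf phi.

Let b x := phi x * phi x.

Let bb : bumpf b.
Proof. by apply: bumpM => //; case: bphi. Qed.

Let e_ i : 'rV[R]_n := delta_mx ord0 i.

Let second_diff_le i : exists2 K : R, 0 <= K & forall t : R, 0 < t <= 1 ->
  \int[mu]_x (S t (e_ i) x * b x) <= K * (t * t).
Proof.
have [sb [M bM]] := bb.
have [L L0 LP] := bump_lipschitz (bump_partial i bb).
have [C C0 CP] := continuous_locally_bounded (M + 1) fcts.
pose A := \int[mu]_x (\1_(@cube R n (M + 1)) x : R).
have ind : mu.-integrable setT (EFin \o (\1_(@cube R n (M + 1)) : _ -> R)).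
  apply: (@integrable_bounded_support _ _ _ (M + 1) 1).
  - by apply: measurable_indic; exact: measurable_cube.
  - by move=> x; rewrite indicE; case: (_ \in _); rewrite ?normr1 ?normr0.
  - move=> x xM; rewrite indicE memNset//.
    by rewrite /cube /=; apply/negP; rewrite -ltNge.
exists (C * (L * 2) * A).
  by rewrite !mulr_ge0//; apply: Rintegral_ge0 => x _; rewrite indicE.
move=> t /andP[t0 t1].
have cs v : continuous (fun x => f (x + v)).
  move=> x; apply: (@continuous_comp _ _ _ (fun y => y + v) f); last exact: fcts.
  by apply: continuousD; [exact: cvg_id|exact: cst_continuous].
have If v : mu.-integrable setT (EFin \o (fun x => f (x + v) * b x)).
  exact: continuous_mul_bump_integrable.
have Ib v : mu.-integrable setT (EFin \o (fun x => f x * b (x + v))).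
  by apply: continuous_mul_bump_integrable => //; exact: bump_shift.
have I0 : mu.-integrable setT (EFin \o (fun x => f x * b x)).
  exact: continuous_mul_bump_integrable.
have shift v : \int[mu]_x (f (x + v) * b x) = \int[mu]_x (f x * b (x + - v)).
  rewrite -(@Rintegral_shift _ _ v (fun x => f x * b (x + - v))).
    by apply: eq_Rintegral => x _; rewrite addrK.
  by have /integrableP[/measurable_EFinP] := Ib (- v).
have I2 : mu.-integrable setT (EFin \o (fun x => 2 * (f x * b x))).
  exact: (integrableZl measurableT 2 I0).
have ID : mu.-integrable setT
    (EFin \o (fun x => f (x + t *: e_ i) * b x + f (x + - (t *: e_ i)) * b x)).
  exact: (integrableD measurableT (If _) (If _)).
have ID' : mu.-integrable setT
    (EFin \o (fun x => f x * b (x + - (t *: e_ i)) + f x * b (x + - - (t *: e_ i)))).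
  exact: (integrableD measurableT (Ib _) (Ib _)).
have -> : \int[mu]_x (S t (e_ i) x * b x) =
    \int[mu]_x (f x * b (x + - (t *: e_ i)) + f x * b (x + - - (t *: e_ i))
      - 2 * (f x * b x)).
  rewrite RintegralB// RintegralD// -!shift -RintegralD// -RintegralB//.
  by apply: eq_Rintegral => x _; rewrite /S; ring.
have Cb x : `|b (x - t *: e_ i) + b (x - - (t *: e_ i)) - 2 * b x| <=
    L * 2 * (t * t).
  have mv y : exists2 s, 0 <= s <= 1 &
      b (y + t *: e_ i) - b y = t * partial i b (y + s *: (t *: e_ i)).
    have D s := is_deriveZv t (smooth_derivable (y + s *: (t *: e_ i)) i sb).
    have [|s s01] := @mvt_segment _ _ b y (t *: e_ i).
      by move=> s _; have [] := D s.
    by have [_ ->] := D s => E; exists s.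
  have [s1 s11 E1] := mv x; have [s2 s21 E2] := mv (x - t *: e_ i).
  rewrite subrK in E2; rewrite opprK.
  rewrite (_ : _ - 2 * b x = (b (x + t *: e_ i) - b x) -
    (b x - b (x - t *: e_ i))); last by ring.
  rewrite E1 E2 -mulrBr normrM gtr0_norm// [leRHS]mulrC -[leRHS]mulrA.
  rewrite ler_pM2l//; apply: (le_trans (LP _ _)).
  rewrite (_ : t * (L * 2) = L * (2 * t)); last by ring.
  rewrite ler_wpM2l//.
  rewrite (_ : _ - _ = (s1 + 1 - s2) *: (t *: e_ i)).
    rewrite normrZ normrZ (gtr0_norm t0).
    case/andP : s11 => s1a s1b; case/andP : s21 => s2a s2b.
    rewrite ger0_norm; last lra.
    have := norm_delta_mx_le1 (R := R) i; rewrite -/(e_ i) => ei.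
    apply: (@le_trans _ _ (2 * (t * 1))); last by rewrite mulr1 mulrC.
    apply: ler_pM => //; [lra|by rewrite mulr_ge0// ltW|lra|].
    by rewrite ler_pM2l.
  by apply/rowP => j; rewrite !mxE; ring.
pose K := C * (L * 2) * (t * t).
have K0 : 0 <= K by rewrite !mulr_ge0// ltW.
have IK : mu.-integrable setT
    (EFin \o (fun x => K * (\1_(@cube R n (M + 1)) x : R))).
  exact: (integrableZl measurableT K ind).
apply: (@le_trans _ _ (\int[mu]_x (K * (\1_(@cube R n (M + 1)) x : R)))).
  apply: le_Rintegral => //; first exact: (integrableB measurableT ID' I2).
  move=> x _; apply: (le_trans (ler_norm _)).
  rewrite (_ : _ - _ = f x * (b (x - t *: e_ i) + b (x - - (t *: e_ i)) - 2 * b x)).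
    rewrite normrM indicE; have [xM|xM] := boolP (x \in cube _).
      rewrite mulr1 /K -mulrA; apply: ler_pM => //.
      by apply: CP; move/set_mem : xM.
    rewrite mulr0; move: xM; rewrite notin_setE /cube/= => /negP; rewrite -ltNge => xM.
    have te : `|t *: e_ i| <= 1.
      by rewrite normrZ (gtr0_norm t0) mulr_ile1 ?norm_delta_mx_le1// ltW.
    have far w : `|w| <= 1 -> M < `|x + w|.
      move=> w1; have : `|x| <= `|x + w| + `|w|.
        by rewrite -{1}(addrK w x) (le_trans (ler_normB _ _)).
      lra.
    rewrite !bM ?opprK ?far ?normrN//; last by lra.
    by rewrite addr0 mulr0 subr0 normr0 mulr0.
  ring.
rewrite RintegralZl// -/A /K.
by rewrite mulrAC.
Qed.

(** These sets exhaust the points of the support of [phi] at which the second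
    difference quotients do not become small. *)
Let bad i (m : nat) : set 'rV[R]_n := [set x | phi x != 0 /\
  forall j : nat, m.+1%:R^-1 * j.+1%:R^-1 <= S j.+1%:R^-1 (e_ i) x].

Let S_cts t v : continuous (S t v).
Proof.
have cs w : continuous (fun x => f (x + w)).
  move=> x; apply: (@continuous_comp _ _ _ (fun y => y + w) f); last exact: fcts.
  by apply: continuousD; [exact: cvg_id|exact: cst_continuous].
have c2 : continuous (fun x => 2 * f x).
  move=> x; apply: (@continuousM _ _ (fun=> 2) f); last exact: fcts.
  exact: cst_continuous.
move=> x; apply: (@continuousB _ _ _ (fun x => f (x + t *: v) + f (x - t *: v))
  (fun x => 2 * f x) x (@continuousD _ _ _ _ _ x (cs _ x) (cs _ x)) (c2 x)).
Qed.

Let measurable_bad i m : measurable (bad i m).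
Proof.
have mge t v c : measurable [set x | c <= S t v x].
  have := continuous_measurable_row (@S_cts t v) measurableT (measurable_itv `[c, +oo[).
  by rewrite setTI; congr (measurable _); apply/seteqP; split=> x /=;
    rewrite in_itv/= andbT.
rewrite (_ : bad i m = [set x | phi x != 0] `&`
    \bigcap_j [set x | m.+1%:R^-1 * j.+1%:R^-1 <= S j.+1%:R^-1 (e_ i) x]).
  apply: measurableI; last exact: bigcapT_measurable.
  apply: open_measurable_row.
  rewrite (_ : mkset _ = phi @^-1` [set r | r != 0]); last by [].
  move/continuousP : (smooth_continuous bphi.1); apply; exact: open_neq.
by apply/seteqP; split=> x /= [p0 H]; split=> // j; [move=> _|]; exact: H.
Qed.

Let bad_null i m : mu (bad i m) = 0%E.
Proof.
have [K K0 KP] := second_diff_le i.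
have mb := measurable_bad i m.
have Ib : mu.-integrable setT (EFin \o b) := bump_integrable bb.
have b0 x : 0 <= b x by rewrite /b -expr2 sqr_ge0.
pose B := \int[mu]_(x in bad i m) b x.
have B0 : B = 0.
  apply/eqP; rewrite eq_le; apply/andP; split; last first.
    by apply: Rintegral_ge0 => x _; exact: b0.
  apply/ler_addgt0Pr => e e0; rewrite add0r.
  have [j Kj] : exists j : nat, 0 + j.+1%:R^-1 < e / (m.+1%:R * (K + 1)).
    by apply: ltr_add_invr; rewrite divr_gt0// mulr_gt0// ltr_wpDl.
  rewrite add0r in Kj; set t : R := j.+1%:R^-1 in Kj.
  have t0 : 0 < t by rewrite invr_gt0.
  have t1 : t <= 1 by rewrite /t invf_le1// ler1n.
  have := KP t; rewrite t0 t1 => /(_ isT) Kt.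
  have c0 : 0 < m.+1%:R^-1 * t by rewrite mulr_gt0// invr_gt0.
  have IS : mu.-integrable setT (EFin \o (fun x => S t (e_ i) x * b x)).
    exact: continuous_mul_bump_integrable (@S_cts t (e_ i)) bb.
  have ISb := integrableS measurableT mb (@subsetT _ _) IS.
  have Ibb := integrableS measurableT mb (@subsetT _ _) Ib.
  have : m.+1%:R^-1 * t * B <= K * (t * t).
    apply: le_trans Kt; rewrite /B -RintegralZl//.
    apply: (@le_trans _ _ (\int[mu]_(x in bad i m) (S t (e_ i) x * b x))).
      apply: le_Rintegral => //; first exact: (integrableZl mb (m.+1%:R^-1 * t) Ibb).
      by move=> x [_ /(_ j) Sx]; rewrite ler_wpM2r.
    rewrite Rintegral_mkcond; apply: le_Rintegral => //.
      by rewrite -restrict_EFin; apply/(integrable_mkcond _ mb).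
    move=> x _; rewrite /patch; case: ifP => // _.
    by rewrite mulr_ge0.
  have -> : K * (t * t) = m.+1%:R^-1 * t * (m.+1%:R * K * t).
    by field; rewrite addrC natr1 pnatr_eq0.
  rewrite ler_pM2l// => /le_trans; apply.
  move/ltW : Kj; rewrite ler_pdivlMr ?mulr_gt0 ?ltr_wpDl// mulrC.
  apply: le_trans; rewrite ler_wpM2r ?(ltW t0)// ler_wpM2l// lerDl.
  by [].
have : (\int[mu]_(x in bad i m) `|(b x)%:E|)%E = 0%E.
  under eq_integral do rewrite gee0_abs ?lee_fin ?b0//.
  have Ibb := integrableS measurableT mb (@subsetT _ _) Ib.
  rewrite -(fineK (integrable_fin_num mb Ibb)).
  by rewrite -[fine _]/B B0.
have mbm : measurable_fun (bad i m) (EFin \o b).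
  by have /integrableP[mm _] := Ib; exact: measurable_funTS.
move/(ae_eq_integral_abs mu mb mbm) => [N [mN N0 NP]].
apply/eqP; rewrite eq_le measure_ge0 andbT -N0.
apply: le_measure; rewrite ?inE// => x bx; apply: NP => /=.
move=> /(_ bx) [] /eqP; rewrite mulf_eq0 orbb; apply/negP.
by case: bx.
Qed.

(** Integrating the second difference quotients against a smooth weight and
    moving the differences onto the weight shows that they tend to 0 in the
    mean, so the set where they stay away from 0 is null. *)
Lemma convex_ae_derivable : exists N : set 'rV[R]_n,
  [/\ measurable N, mu N = 0%E & forall x, ~ N x -> phi x != 0 ->
    forall i, derivable f x (delta_mx ord0 i)].
Proof.
have : mu.-negligible (\bigcup_p (if unpickle p is Some im
    then bad (im : 'I_n * nat)%type.1 im.2 else set0)).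
  apply: negligible_bigcup => p; case: unpickle => [[i m]|].
    by exists (bad i m); split => //; exact: bad_null.
  exact: negligible_set0.
move=> [N [mN N0 NP]]; exists N; split=> // x Nx px i.
apply: convex_derivable => e e0; apply: contrapT => H; apply: Nx; apply: NP.
have [m me] : exists m : nat, 0 + m.+1%:R^-1 < e by exact: ltr_add_invr.
rewrite add0r in me.
exists (pickle (i, m)) => //; rewrite pickleK; split=> // j.
rewrite leNgt; apply/negP => Sj; apply: H; exists j.+1%:R^-1.
  by rewrite invr_gt0.
by apply: (le_trans (ltW Sj)); rewrite ler_wpM2r// ltW.
Qed.

End convex_ae.

(** * The distance is differentiable almost everywhere *)

Section grad_dist.
Context {R : realType} {n : nat}.
Local Notation mu := (@lebesgue_row R n).
Implicit Types (x y v p q : 'rV[R]_n).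

Variable F : 'rV[R]_n -> R.
Hypothesis hF : strongly_convex_norm F.
Variable Omega : set 'rV[R]_n.
Hypothesis hbd : boundary Omega !=set0.
Let d := dist_boundary F Omega.

(** The distance is differentiable almost everywhere because its square differs
    from a quadratic polynomial by a convex function. *)
Lemma dist_ae_differentiable (phi : 'rV[R]_n -> R) : bumpf phi ->
  exists N : set 'rV[R]_n, [/\ measurable N, mu N = 0%E &
    forall x, ~ N x -> phi x != 0 -> 0 < d x ->
    forall v, is_derive x v d (dotp (gradient d x) v)].
Proof.
move=> bphi; have [C C0 CP] := dist_sqr_semiconcave hF hbd.
have [L L0 LP] := dist_lipschitz hF hbd.
pose psi x := C * dotp x x - d x ^+ 2.
have psi_convex (x y : 'rV[R]_n) (t : R) : 0 <= t <= 1 ->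
    psi (t *: x + (1 - t) *: y) <= t * psi x + (1 - t) * psi y.
  move=> t01; have := CP x y t t01; rewrite /psi -/d.
  rewrite !(dotpDl, dotpDr, dotpZl, dotpZr, dotpNl, dotpNr) (dotpC y x).
  by move: (d x ^+ 2) (d y ^+ 2) (d _ ^+ 2) => a b c; lra.
have dcts : continuous d := lipschitz_cts LP.
have sdot : smooth (fun x : 'rV[R]_n => dotp x x).
  move=> r; rewrite /dotp.
  elim: (index_enum _) => [|i s IH].
    apply: Ck_ext openT _ (Ck_cst r 0 openT) => x _.
    by rewrite big_nil.
  apply: Ck_ext openT _ (CkD openT (CkM openT (smooth_coord i r) (smooth_coord i r)) IH).
  by move=> x _; rewrite big_cons.
have psi_cts : continuous psi.
  move=> x; apply: (@continuousB _ _ _ (fun x => C * dotp x x) (fun x => d x ^+ 2)).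
    apply: (@continuousM _ _ (fun=> C) (fun x : 'rV[R]_n => dotp x x)).
      exact: cst_continuous.
    exact: smooth_continuous.
  by apply: (@continuousM _ _ d d); exact: dcts.
have [N [mN N0 NP]] := convex_ae_derivable psi_convex psi_cts bphi.
exists N; split => // x Nx px dx.
have dpsi := NP x Nx px.
pose q := (2 * Num.sqrt (d x ^+ 2))^-1 *: ((2 * C) *: x - gradient psi x).
suff D v : is_derive x v d (dotp q v) by rewrite (gradient_unique D).
have D1 : is_derive x v (fun y => C * dotp y y - psi y)
    (C * (2 * dotp x v) - dotp (gradient psi x) v).
  apply: is_deriveB; last exact: convex_is_derive.
  exact: (is_deriveZ C (is_derive_dotp_sqr x v)).
rewrite (_ : (fun y => C * dotp y y - psi y) = (fun y => d y ^+ 2)) in D1; last first.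
  by apply/funext => y; rewrite /psi; ring.
have d2 : 0 < d x ^+ 2 by rewrite exprn_gt0.
have := is_derive_sqrt_fun d2 D1.
rewrite (_ : (fun y => Num.sqrt (d y ^+ 2)) = d); last first.
  by apply/funext => y; rewrite sqrtr_sqr ger0_norm// dist_ge0.
congr is_derive.
by rewrite /q dotpZl dotpDl dotpZl dotpNl; congr (_ * _); ring.
Qed.

End grad_dist.

(** * The inequality for a test function and a shifted weight *)

Section partial_sqr_div.
Context {R : realType} {n : nat}.

Lemma partial_sqr_div (g phi : 'rV[R]_n -> R) (c : R) x i :
  (g x + c == 0) = false ->
  is_derive x (delta_mx ord0 i) g (partial i g x) ->
  is_derive x (delta_mx ord0 i) phi (partial i phi x) ->
  partial i (fun y => (g y + c)^-1 * (phi y * phi y)) x =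
  2 * phi x * partial i phi x / (g x + c) -
  phi x * phi x * partial i g x / (g x + c) ^+ 2.
Proof.
move=> n0 D1 D2; have {}n0 : g x + c != 0 by rewrite n0.
have [D31 D32] : is_derive x (delta_mx ord0 i) (fun x => g x + c) (partial i g x).
  by rewrite -[X in is_derive _ _ _ X]addr0; apply: is_deriveD.
have D4 : is_derive x (delta_mx ord0 i) (fun x => (g x + c)^-1)
    (- (g x + c) ^- 2 * partial i g x).
  apply: DeriveDef; first exact: derivableV.
  by rewrite -D32; exact: (@deriveV _ _ (fun x => g x + c) _ _ n0 D31).
have [_ E] := is_deriveM D4 (is_deriveM D2 D2).
transitivity ((g x + c)^-1 *
  (phi x * partial i phi x + phi x * partial i phi x) +
  phi x * phi x * (- (g x + c) ^- 2 * partial i g x)); first exact: E.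
by field.
Qed.

End partial_sqr_div.

Section hardy_test.
Context {R : realType} {n : nat}.
Local Notation mu := (@lebesgue_row R n).
Variable F : 'rV[R]_n -> R.
Hypothesis hF : strongly_convex_norm F.
Variable Omega : set 'rV[R]_n.
Hypothesis oOmega : open Omega.
Hypothesis hbd : boundary Omega !=set0.
Local Notation d := (dist_boundary F Omega).
Hypothesis hd : finsler_superharmonic F Omega d.
Variable phi : 'rV[R]_n -> R.
Hypothesis tphi : test_function Omega phi.
Variable delta : R.
Hypothesis delta0 : 0 < delta.
Implicit Types (x y v p q : 'rV[R]_n).

Lemma test_function_bump f : test_function Omega f -> bumpf f.
Proof.
move=> [sf cf _]; split => //.
have [M [_ MP]] := compact_bounded cf.
exists (M + 1) => x xM; apply/eqP; apply: contraLR xM => fx.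
rewrite -leNgt; apply: (MP (M + 1)); first by rewrite ltrDl.
exact: subset_closure.
Qed.

Let bphi : bumpf phi := test_function_bump tphi.
Let sphi : smooth phi := bphi.1.
Let e_ i : 'rV[R]_n := delta_mx ord0 i.

Let phi2 x := phi x * phi x.
Let bphi2 : bumpf phi2.
Proof. exact: bumpM. Qed.
Let phi2_ge0 x : 0 <= phi2 x.
Proof. by rewrite /phi2 -expr2 sqr_ge0. Qed.

Let mass : R := \int[mu]_x phi2 x.

Let d_ge0 x : 0 <= d x := dist_ge0 hF hbd x.
Let den_gt0 x : 0 < d x + delta.
Proof. by rewrite ltr_wpDl. Qed.

Lemma integrable_grad_sqr : mu.-integrable setT
  (EFin \o (fun x => F (gradient phi x) ^+ 2)).
Proof.
have [C C0 CP] := seminorm_bounded (scn_ge0 hF) (finslerD hF) (scn_homogeneous hF).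
have [M kM] := bphi.2.
have [B BP] : exists B : 'I_n -> R, forall i, 0 <= B i /\
    forall x, `|partial i phi x| <= B i.
  apply: (@fin_all_exists _ (fun=> R) (fun i B => 0 <= B /\
    forall x, `|partial i phi x| <= B)) => i.
  by have [B B0 BP] := bump_bounded (bump_partial i bphi); exists B.
have Bs : 0 <= \sum_i B i by apply: sumr_ge0 => i _; have [] := BP i.
apply: (@integrable_bounded_support _ _ _ M ((C * \sum_i B i) ^+ 2)).
- apply: measurable_funX; apply: continuous_comp_row_measurable => //.
    exact: finsler_continuous.
  move=> i; under eq_fun do rewrite mxE.
  apply: continuous_measurable_row; apply: smooth_continuous.
  exact: smooth_partial.
- move=> x; rewrite ger0_norm ?sqr_ge0// ler_pXn2r ?nnegrE ?(scn_ge0 hF)//.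
    apply: (le_trans (CP _)); rewrite ler_pM2l//.
    apply: norm_le_coord => // i; rewrite mxE.
    apply: (@le_trans _ _ (B i)); first by have [_] := BP i; exact.
    by rewrite (bigD1 i)//= lerDl; apply: sumr_ge0 => j _; have [] := BP j.
  by rewrite mulr_ge0// ltW.
- move=> x xM; rewrite (_ : gradient phi x = 0) ?finsler0// ?expr0n//.
  by apply/rowP => i; rewrite !mxE; exact: vanishes_partial xM.
Qed.

Let dcts : continuous d.
Proof.
have [L L0 LP] := dist_lipschitz hF hbd; exact: lipschitz_cts LP.
Qed.

Let weighted x := phi2 x / (d x + delta) ^+ 2.

Lemma integrable_weighted : mu.-integrable setT (EFin \o weighted).
Proof.
have c : continuous (fun x => ((d x + delta) ^+ 2)^-1).
  move=> x; apply: (@continuousV _ _ (fun x => (d x + delta) ^+ 2) x).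
    by rewrite gt_eqF// exprn_gt0.
  have cD : {for x, continuous (fun x => d x + delta)}.
    by apply: continuousD; [exact: dcts|exact: cst_continuous].
  exact: (@continuousM _ _ _ _ x cD cD).
have := continuous_mul_bump_integrable c bphi2.
by apply: eq_integrable => // x _ /=; rewrite mulrC.
Qed.

(** The squared test function, normalised, is itself a mollifier. *)
Let k x := mass^-1 * phi2 x.

Hypothesis mass_gt0 : 0 < mass.

Let bk : bumpf k.
Proof. exact: bumpM (smooth_cst _) bphi2. Qed.

Let k_ge0 x : 0 <= k x.
Proof. by rewrite /k mulr_ge0// invr_ge0 ltW. Qed.

Let k_mass : \int[mu]_x k x = 1.
Proof.
rewrite /k RintegralZl//; last exact: bump_integrable.
by rewrite mulVf// gt_eqF.
Qed.

Let dm (m : nat) := mollify d k m.+1%:R^-1.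

Let eps_gt0 m : 0 < m.+1%:R^-1 :> R.
Proof. by rewrite invr_gt0. Qed.

Let dm_smooth m : smooth (dm m).
Proof.
have [L L0 LP] := dist_lipschitz hF hbd.
by apply: (mollify_smooth LP bk); rewrite gt_eqF.
Qed.

Let dm_ge0 m x : 0 <= dm m x.
Proof. exact: mollify_ge0. Qed.

Let denm_gt0 m x : 0 < dm m x + delta.
Proof. by rewrite ltr_wpDl. Qed.

(** The test function is the square of [phi] over a smoothed distance, made
    positive by adding [delta]. *)
Let psi m x := (dm m x + delta)^-1 * phi2 x.

Let den_smooth m : smooth (fun x => (dm m x + delta)^-1).
Proof.
move=> r; apply: CkV; first exact: openT.
  by move=> x _; rewrite gt_eqF.
by apply: CkD; [exact: openT|exact: dm_smooth|apply: Ck_cst; exact: openT].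
Qed.

Let psi_test m : test_function Omega (psi m).
Proof.
have [_ cphi sub] := tphi.
have S : [set x | psi m x != 0] `<=` [set x | phi x != 0].
  move=> x /=; apply: contra => /eqP p0.
  by rewrite /psi /phi2 p0 !mulr0.
have S' := closureS S.
split; first by have [] := bumpM (@den_smooth m) bphi2.
  exact: subclosed_compact (@closed_closure _ _) cphi S'.
exact: subset_trans S' sub.
Qed.

Let psi_ge0 m x : 0 <= psi m x.
Proof. by rewrite /psi mulr_ge0// invr_ge0 ltW. Qed.

Let partial_psi m i x : partial i (psi m) x =
  2 * phi x * partial i phi x / (dm m x + delta) -
  phi2 x * partial i (dm m) x / (dm m x + delta) ^+ 2.
Proof.
exact: (partial_sqr_div (gt_eqF (denm_gt0 m x))
  (smooth_derivable x i (@dm_smooth m)) (smooth_derivable x i sphi)).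
Qed.

(** Testing superharmonicity with [psi m] and letting [m] tend to infinity gives,
    with [p] the gradient of the distance and [F p = 1],
    0 <= integral of 2 phi / (d + delta) * grad F(p).grad phi - phi^2 / (d + delta)^2.
    Since grad F(p).v <= F v, Young's inequality absorbs half of the negative term. *)
Lemma hardy_test_pos_mass :
  \int[mu]_(x in Omega) weighted x <=
  4 * \int[mu]_(x in Omega) (F (gradient phi x) ^+ 2).
Proof.
have [L L0 LP] := dist_lipschitz hF hbd.
have [N [mN N0 NP]] := dist_ae_differentiable hF hbd bphi.
have mO := open_measurable_row oOmega.
have mphi0 : measurable [set x | phi x != 0].
  apply: open_measurable_row.
  rewrite (_ : mkset _ = phi @^-1` [set r | r != 0]); last by [].
  by move/continuousP : (smooth_continuous sphi); apply; exact: open_neq.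
pose E := (Omega `&` [set x | phi x != 0]) `\` N.
have mE : measurable E by apply: measurableD => //; exact: measurableI.
(* The integrands vanish where [phi] does, and [N] is null. *)
have toE (f : 'rV[R]_n -> R) : (forall x, phi x = 0 -> f x = 0) ->
    \int[mu]_(x in Omega) f x = \int[mu]_(x in E) f x.
  move=> f0; rewrite /Rintegral (integral_setD_null _ _ mN N0).
  congr fine; rewrite integral_mkcond [RHS]integral_mkcond.
  apply: eq_integral => x _; rewrite /patch !in_setD in_setI.
  case: (x \in Omega) => //=; case: (x \in N) => //=; rewrite ?andbF//= ?andbT.
  case: ifPn => //; rewrite notin_setE /= => /negP; rewrite negbK => /eqP /f0 ->.
  by [].
have DE x : E x -> forall v, is_derive x v d (dotp (gradient d x) v).
  move=> [[Ox p0] nNx] v; apply: NP => //; exact: dist_gt0.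
have F1 x : E x -> F (gradient d x) = 1.
  move=> Ex; apply/eqP; rewrite eq_le.
  rewrite (finsler_grad_dist_le1 hF hbd (DE x Ex)) /=.
  by have [[Ox _] _] := Ex; exact: (finsler_grad_dist_ge1 hF hbd oOmega Ox (DE x Ex)).
have g0 x : E x -> gradient d x != 0.
  move=> /F1 H; apply/eqP => g0; move: H; rewrite g0 finsler0// => /eqP.
  by rewrite eq_sym oner_eq0.
have mgrad i : measurable_fun E (fun x => gradient d x ord0 i).
  under eq_fun do rewrite mxE.
  apply: measurable_derive => // x Ex.
  by have [] := DE x Ex (delta_mx ord0 i).
have mF i : measurable_fun E (fun x => partial i F (gradient d x)).
  apply: (@measurable_derive_comp _ _ E F (gradient d) (e_ i)) => //.
    exact: finsler_continuous.
  by move=> x Ex; apply: finsler_derivable => //; exact: g0.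
have flux_le x i : E x -> `|partial i F (gradient d x)| <= F (e_ i).
  move=> Ex; have := dotp_grad_finsler_le hF (e_ i) (g0 x Ex).
  have := dotp_grad_finsler_le hF (- e_ i) (g0 x Ex).
  rewrite dotpNr finslerN// /e_ dotp_delta mxE ler_norml => h1 h2.
  by rewrite h2 andbT; lra.
have [B B0 BP] := partial_mollify_le (ltW L0) LP bk.
pose f m x := F (gradient d x) *
  dotp (gradient F (gradient d x)) (gradient (psi m) x).
have f_ge0 m : 0 <= \int[mu]_(x in E) f m x.
  rewrite -toE; first exact: hd (psi_test m) (psi_ge0 m).
  move=> x p0; rewrite /f (_ : gradient (psi m) x = 0) ?dotp0r ?mulr0//.
  by apply/rowP => i; rewrite !mxE partial_psi /phi2 p0 !(mulr0, mul0r) subr0.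
pose fm m x := \sum_i partial i F (gradient d x) * partial i (psi m) x.
have fE m : \int[mu]_(x in E) f m x = \int[mu]_(x in E) fm m x.
  apply: eq_Rintegral => x /set_mem Ex; rewrite /f F1// mul1r.
  by apply: eq_bigr => i _; rewrite !mxE.
pose flim x := \sum_i partial i F (gradient d x) *
  (2 * phi x * partial i phi x / (d x + delta) -
   phi2 x * gradient d x ord0 i / (d x + delta) ^+ 2).
pose g x := \sum_i F (e_ i) * (2 / delta * `|phi x * partial i phi x| +
   B / delta ^+ 2 * phi2 x).
have mfm m : measurable_fun E (fm m).
  apply: measurable_sum => i; apply: measurable_funM => //.
  apply: measurable_funTS; apply: continuous_measurable_row.
  apply: smooth_continuous; apply: smooth_partial.
  by have [] := psi_test m.
have fm_lim x : E x -> fm ^~ x @ \oo --> flim x.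
  move=> Ex; apply: cvg_sum_fin => i; apply: cvgM; first exact: cvg_cst.
  under eq_fun do rewrite partial_psi.
  have c1 : (fun m => dm m x + delta) @ \oo --> d x + delta.
    apply: cvgD; last exact: cvg_cst.
    exact: (mollify_cvg (ltW L0) LP bk k_ge0 k_mass).
  have n0 : d x + delta != 0 by rewrite gt_eqF.
  have c2 : (fun m => (dm m x + delta)^-1) @ \oo --> (d x + delta)^-1.
    exact: cvgV.
  apply: cvgB; first by apply: cvgM => //; exact: cvg_cst.
  apply: cvgM.
    apply: cvgM; first exact: cvg_cst.
    exact: (partial_mollify_cvg LP bk k_mass (DE x Ex)).
  under eq_fun do rewrite expr2 invfM.
  by rewrite expr2 invfM; apply: cvgM.
have ig : mu.-integrable setT (EFin \o g).
  apply: (Rintegral_sum _ measurableT _).1 => i.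
  have h1 := integrable_norm (bump_integrable (bumpM sphi (bump_partial i bphi))).
  have h2 := integrableZl measurableT (2 / delta) h1.
  have h3 := integrableZl measurableT (B / delta ^+ 2) (bump_integrable bphi2).
  exact: (integrableZl measurableT (F (e_ i)) (integrableD measurableT h2 h3)).
have igE := integrableS measurableT mE (@subsetT _ _) ig.
have fm_le m x : E x -> `|fm m x| <= g x.
  move=> Ex; apply: (le_trans (ler_norm_sum _ _ _)); apply: ler_sum => i _.
  rewrite normrM; apply: ler_pM => //; first exact: flux_le.
  rewrite partial_psi; apply: (le_trans (ler_normB _ _)).
  have i1 : (dm m x + delta)^-1 <= delta^-1.
    by rewrite lef_pV2 ?posrE// lerDr.
  have i0 : 0 <= (dm m x + delta)^-1 by rewrite invr_ge0 ltW.
  apply: lerD.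
    rewrite normrM (ger0_norm i0) -[2 * _ * _]mulrA normrM [`|2|]ger0_norm//.
    by rewrite mulrAC; apply: ler_wpM2r => //; exact: ler_wpM2l.
  rewrite normrM normrM (ger0_norm (phi2_ge0 x)) -exprVn normrX (ger0_norm i0).
  rewrite -mulrA [leRHS]mulrC; apply: ler_wpM2l => //.
  apply: ler_pM; rewrite ?exprn_ge0//; first exact: (BP _ _ _ (eps_gt0 m)).
  by rewrite -exprVn ler_pXn2r ?nnegrE// invr_ge0 ltW.
have [iflim clim] := Rintegral_dominated_cvg mE mfm fm_lim igE fm_le.
have flim_ge0 : 0 <= \int[mu]_(x in E) flim x.
  rewrite -(cvg_lim _ clim)//; apply: limr_ge.
    by apply/cvg_ex; exists (\int[mu]_(x in E) flim x).
  by apply: nearW => m; rewrite -fE; exact: f_ge0.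
have flim_le x : E x -> flim x <= 2 * F (gradient phi x) ^+ 2 - 2^-1 * weighted x.
  move=> Ex; pose a := phi x / (d x + delta).
  have -> : flim x = 2 * (d x + delta)^-1 *
      dotp (gradient F (gradient d x)) (phi x *: gradient phi x) -
      weighted x * dotp (gradient F (gradient d x)) (gradient d x).
    rewrite /flim /dotp !mulr_sumr -sumrB; apply: eq_bigr => i _.
    by rewrite !mxE /weighted; ring.
  rewrite dotp_grad_finsler_id ?g0// F1// mulr1.
  have := dotp_grad_finsler_le hF (phi x *: gradient phi x) (g0 x Ex).
  rewrite (scn_homogeneous hF) => H.
  have i0 : 0 < (d x + delta)^-1 by rewrite invr_gt0.
  have := ler_wpM2l (ltW i0) H.
  set D := dotp _ _; set G := F (gradient phi x).
  have -> : weighted x = ((d x + delta)^-1 * `|phi x|) ^+ 2.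
    by rewrite exprMn -normrX ger0_norm ?sqr_ge0// exprVn mulrC /weighted /phi2 expr2.
  have := sqr_ge0 ((d x + delta)^-1 * `|phi x| - 2 * G).
  rewrite mulrA; move: ((d x + delta)^-1 * `|phi x|) ((d x + delta)^-1) => A D'.
  by rewrite !expr2; lra.
have iw : mu.-integrable E (EFin \o weighted).
  exact: (integrableS measurableT mE (@subsetT _ _) integrable_weighted).
have iGT := integrable_grad_sqr.
have iG := integrableS measurableT mE (@subsetT _ _) iGT.
have iG2 : mu.-integrable E (EFin \o (fun x => 2 * F (gradient phi x) ^+ 2)).
  exact: (integrableZl mE 2 iG).
have iw2 : mu.-integrable E (EFin \o (fun x => 2^-1 * weighted x)).
  exact: (integrableZl mE 2^-1 iw).
have : 0 <= \int[mu]_(x in E) (2 * F (gradient phi x) ^+ 2 - 2^-1 * weighted x).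
  apply: (le_trans flim_ge0); apply: le_Rintegral => //.
  exact: (integrableB mE iG2 iw2).
rewrite RintegralB// RintegralZl// RintegralZl//.
rewrite (toE weighted); last by move=> x p0; rewrite /weighted /phi2 p0 !mul0r.
have GE : \int[mu]_(x in E) (F (gradient phi x) ^+ 2) <=
    \int[mu]_(x in Omega) (F (gradient phi x) ^+ 2).
  rewrite Rintegral_mkcond [leRHS]Rintegral_mkcond; apply: le_Rintegral => //.
  - by rewrite -restrict_EFin; apply/(integrable_mkcond _ mE).
  - rewrite -restrict_EFin; apply/(integrable_mkcond _ mO).
    exact: (integrableS measurableT mO (@subsetT _ _) iGT).
  move=> x _; rewrite /patch; case: ifPn => [/set_mem [[Ox _] _]|_].
    by rewrite ifT//; exact: mem_set.
  by case: ifP => // _; exact: sqr_ge0.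
lra.
Qed.

End hardy_test.

(** * The Hardy inequality *)

Section hardy.
Context {R : realType} {n : nat}.
Local Notation mu := (@lebesgue_row R n).
Variable F : 'rV[R]_n -> R.
Hypothesis hF : strongly_convex_norm F.
Variable Omega : set 'rV[R]_n.
Hypothesis oOmega : open Omega.
Hypothesis hbd : boundary Omega !=set0.
Local Notation d := (dist_boundary F Omega).
Hypothesis hd : finsler_superharmonic F Omega d.

Let mO : measurable Omega := open_measurable_row oOmega.
Let d_ge0 x : 0 <= d x := dist_ge0 hF hbd x.

Lemma hardy_test phi (delta : R) : test_function Omega phi -> 0 < delta ->
  (\int[mu]_(x in Omega) (phi x ^+ 2 / (d x + delta) ^+ 2)%:E <=
   4%:E * \int[mu]_(x in Omega) (F (gradient phi x) ^+ 2)%:E)%E.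
Proof.
move=> tphi delta0; have bphi := test_function_bump tphi.
have iw := integrableS measurableT mO (@subsetT _ _)
  (integrable_weighted hF hbd tphi delta0).
have iG := integrableS measurableT mO (@subsetT _ _) (integrable_grad_sqr hF tphi).
have bphi2 := bumpM bphi.1 bphi.
have W_ge0 x : 0 <= phi x * phi x / (d x + delta) ^+ 2.
  by rewrite mulr_ge0 ?invr_ge0 ?sqr_ge0// -expr2 sqr_ge0.
suff : \int[mu]_(x in Omega) (phi x * phi x / (d x + delta) ^+ 2) <=
    4 * \int[mu]_(x in Omega) (F (gradient phi x) ^+ 2).
  under eq_integral do rewrite expr2.
  rewrite -lee_fin EFinM /Rintegral !fineK//; exact: integrable_fin_num.
have : 0 <= \int[mu]_x (phi x * phi x).
  by apply: Rintegral_ge0 => x _; rewrite -expr2 sqr_ge0.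
rewrite le_eqVlt => /predU1P[m0|]; last exact: hardy_test_pos_mass.
apply: (@le_trans _ _ 0); last first.
  by rewrite mulr_ge0//; apply: Rintegral_ge0 => x _; exact: sqr_ge0.
have -> : 0 = delta ^- 2 * \int[mu]_x (phi x * phi x) by rewrite -m0 mulr0.
rewrite -RintegralZl//; last exact: bump_integrable.
rewrite Rintegral_mkcond; apply: le_Rintegral => //.
- by rewrite -restrict_EFin; apply/(integrable_mkcond _ mO).
- exact: (integrableZl measurableT (delta ^- 2) (bump_integrable bphi2)).
move=> x _; rewrite /patch; case: ifP => _; last first.
  by rewrite mulr_ge0 ?invr_ge0 ?sqr_ge0// -expr2 sqr_ge0.
rewrite mulrC ler_wpM2r// -?expr2 ?sqr_ge0//.
rewrite lef_pV2 ?posrE ?exprn_gt0 ?ltr_wpDl//.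
by rewrite ler_pXn2r ?nnegrE ?(ltW delta0) ?lerDr// addr_ge0// ltW.
Qed.

Lemma sqr_split (a b t : R) : 0 < t ->
  a ^+ 2 <= (1 + t) * b ^+ 2 + (1 + t^-1) * (a - b) ^+ 2.
Proof.
move=> t0; have := sqr_ge0 (t * b - (a - b)).
rewrite -(pmulr_rge0 _ (_ : 0 < t^-1)) ?invr_gt0// => H.
have -> : (1 + t) * b ^+ 2 + (1 + t^-1) * (a - b) ^+ 2 =
  a ^+ 2 + t^-1 * (t * b - (a - b)) ^+ 2 by field; rewrite gt_eqF.
by rewrite lerDl.
Qed.

Variables (u : 'rV[R]_n -> R) (Du : 'rV[R]_n -> 'rV[R]_n).
Hypothesis hu : H10 Omega u Du.

Let mu_ : measurable_fun Omega u.
Proof. by have [[[]]] := hu. Qed.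

Let mDu i : measurable_fun Omega (fun x => Du x ord0 i).
Proof. by have [[_ /(_ i)[]]] := hu. Qed.

Let dcts : continuous d.
Proof. have [L L0 LP] := dist_lipschitz hF hbd; exact: lipschitz_cts LP. Qed.

Let mweight (delta : R) (w : 'rV[R]_n -> R) : 0 < delta -> measurable_fun Omega w ->
  measurable_fun Omega (fun x => w x ^+ 2 / (d x + delta) ^+ 2).
Proof.
move=> delta0 mw; apply: measurable_funM; first exact: measurable_funX.
apply: measurable_funTS; apply: continuous_measurable_row => x.
apply: (@continuousV _ _ (fun x => (d x + delta) ^+ 2) x).
  by rewrite gt_eqF// exprn_gt0// ltr_wpDl.
have cD : {for x, continuous (fun x => d x + delta)}.
  by apply: continuousD; [exact: dcts|exact: cst_continuous].
exact: (@continuousM _ _ _ _ x cD cD).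
Qed.

(** The shift by [delta] makes the weight bounded, so that both sides are continuous
    for the convergence of the approximating test functions. The squares are split
    with a weight [t] close to 0 to keep the constant sharp. *)
Lemma hardy_shifted (delta : R) : 0 < delta ->
  (\int[mu]_(x in Omega) (u x ^+ 2 / (d x + delta) ^+ 2)%:E <=
   4%:E * \int[mu]_(x in Omega) (F (Du x) ^+ 2)%:E)%E.
Proof.
move=> delta0.
have [C C0 CP] := seminorm_bounded (scn_ge0 hF) (finslerD hF) (scn_homogeneous hF).
have mFcomp (q : 'rV[R]_n -> 'rV[R]_n) :
    (forall i, measurable_fun Omega (fun x => q x ord0 i)) ->
    measurable_fun Omega (fun x => F (q x) ^+ 2).
  move=> mq; apply: measurable_funX; apply: continuous_comp_row_measurable => //.
  exact: finsler_continuous.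
have mFDu := mFcomp _ mDu.
have B0 : (0 <= \int[mu]_(x in Omega) (F (Du x) ^+ 2)%:E)%E.
  by apply: integral_ge0 => x _; rewrite lee_fin sqr_ge0.
move: (B0); rewrite le_eqVlt => B0'.
have := leey (\int[mu]_(x in Omega) (F (Du x) ^+ 2)%:E)%E.
rewrite le_eqVlt => /predU1P[->|Bfin].
  by rewrite gt0_muley ?leey// lte_fin.
have [b bE] : exists b : R, (\int[mu]_(x in Omega) (F (Du x) ^+ 2)%:E)%E = b%:E.
  exists (fine (\int[mu]_(x in Omega) (F (Du x) ^+ 2)%:E)).
  by rewrite fineK// ge0_fin_numE.
have b0 : 0 <= b by rewrite bE lee_fin in B0.
rewrite bE -EFinM.
pose K1 t : R := (1 + t^-1) * delta ^- 2.
pose K2 t : R := (1 + t^-1) * C ^+ 2.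
suff H (t e : R) : 0 < t -> 0 < e ->
    (\int[mu]_(x in Omega) (u x ^+ 2 / (d x + delta) ^+ 2)%:E <=
    ((1 + t) * (4 * ((1 + t) * b + K2 t * e)) + K1 t * e)%:E)%E.
  apply/lee_addgt0Pr => eta eta0.
  pose t : R := Num.min 1 (eta / (24 * (b + 1))).
  have b1 : 0 < 24 * (b + 1) by lra.
  have t0 : 0 < t by rewrite lt_min ltr01 divr_gt0.
  have t1 : t <= 1 by rewrite ge_min lexx.
  have tb : t * (24 * (b + 1)) <= eta by rewrite -ler_pdivlMr// ge_min lexx orbT.
  pose K := 4 * (1 + t) * K2 t + K1 t.
  have tV : 0 <= 1 + t^-1 by rewrite addr_ge0// invr_ge0 ltW.
  have K0 : 0 <= K.
    have k1 : 0 <= K1 t by rewrite /K1 mulr_ge0// invr_ge0 sqr_ge0.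
    have k2 : 0 <= K2 t by rewrite /K2 mulr_ge0// sqr_ge0.
    by rewrite addr_ge0// !mulr_ge0//; lra.
  pose e := eta / 2 / (K + 1).
  have e0 : 0 < e by rewrite !divr_gt0// ltr_wpDl.
  have Ke : K * e <= eta / 2.
    by rewrite /e mulrCA ger_pMr ?divr_gt0// ler_pdivrMr ?ltr_wpDl// mul1r lerDl.
  apply: (le_trans (H t e t0 e0)); rewrite -EFinD lee_fin.
  have -> : (1 + t) * (4 * ((1 + t) * b + K2 t * e)) + K1 t * e =
      4 * b + 4 * b * t * (2 + t) + K * e by rewrite /K; ring.
  have bt : 4 * b * t * (2 + t) <= 4 * b * t * 3.
    by rewrite ler_wpM2l ?mulr_ge0 ?(ltW t0)//; lra.
  lra.
move=> t0 e0.
have [_ /(_ e e0) [phi tphi]] := hu.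
have sphi : smooth phi by case: tphi.
set X := (X in (X + _)%E); set Y := (X in (_ + X)%E) => XY.
have X0 : (0 <= X)%E by apply: integral_ge0 => x _; rewrite lee_fin sqr_ge0.
have Y0 : (0 <= Y)%E by apply: integral_ge0 => x _; rewrite lee_fin sqr_ge0.
have Xe : (X <= e%:E)%E by apply: le_trans (ltW XY); exact: leeDl.
have Ye : (Y <= e%:E)%E by apply: le_trans (ltW XY); exact: leeDr.
have t1 : 0 <= 1 + t by rewrite addr_ge0// ltW.
have t1' : 0 <= 1 + t^-1 by rewrite addr_ge0// invr_ge0 ltW.
have mphi : measurable_fun Omega phi.
  by apply: measurable_funTS; apply: continuous_measurable_row; exact: smooth_continuous.
have mgphi i : measurable_fun Omega (fun x => gradient phi x ord0 i).
  under eq_fun do rewrite mxE.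
  apply: measurable_funTS; apply: continuous_measurable_row.
  by apply: smooth_continuous; exact: smooth_partial.
have mX : measurable_fun Omega (fun x => (u x - phi x) ^+ 2).
  by apply: measurable_funX; exact: measurable_funB.
have mY : measurable_fun Omega (fun x => euclidean_norm (Du x - gradient phi x) ^+ 2).
  rewrite (_ : (fun x => _) = fun x =>
      \sum_i (Du x ord0 i - gradient phi x ord0 i) ^+ 2).
    apply: measurable_sum => i; apply: measurable_funX.
    by apply: measurable_funB => //; exact: mDu.
  apply/funext => x; rewrite /euclidean_norm sqr_sqrtr ?dotp_ge0//.
  by apply: eq_bigr => i _; rewrite !mxE expr2.
have dominate (f g h : 'rV[R]_n -> R) (p q : R) : 0 <= p -> 0 <= q ->
    measurable_fun Omega f -> measurable_fun Omega g -> measurable_fun Omega h ->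
    (forall x, 0 <= f x) -> (forall x, 0 <= g x) -> (forall x, 0 <= h x) ->
    (forall x, f x <= p * g x + q * h x) ->
    (\int[mu]_(x in Omega) (f x)%:E <= p%:E * \int[mu]_(x in Omega) (g x)%:E +
       q%:E * \int[mu]_(x in Omega) (h x)%:E)%E.
  move=> p0 q0 mf mg mh f0 g0 h0 fgh.
  rewrite -!ge0_integralZl_EFin//; try by [move=> x _; rewrite lee_fin|exact/measurable_EFinP].
  rewrite -ge0_integralD//.
  - apply: ge0_le_integral => //.
    + by move=> x _; rewrite lee_fin.
    + exact/measurable_EFinP.
    + by apply: emeasurable_funD; apply: measurable_funeM; exact/measurable_EFinP.
    + by move=> x _; rewrite -!EFinM -EFinD lee_fin.
  - by move=> x _; rewrite -EFinM lee_fin mulr_ge0.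
  - by apply: measurable_funeM; exact/measurable_EFinP.
  - by move=> x _; rewrite -EFinM lee_fin mulr_ge0.
  - by apply: measurable_funeM; exact/measurable_EFinP.
have s1 : (\int[mu]_(x in Omega) (u x ^+ 2 / (d x + delta) ^+ 2)%:E <=
    (1 + t)%:E * \int[mu]_(x in Omega) (phi x ^+ 2 / (d x + delta) ^+ 2)%:E +
    (K1 t)%:E * X)%E.
  apply: dominate => //.
  - by rewrite /K1 mulr_ge0// invr_ge0 sqr_ge0.
  - exact: mweight.
  - exact: mweight.
  - by move=> x; rewrite mulr_ge0 ?invr_ge0 ?sqr_ge0.
  - by move=> x; rewrite mulr_ge0 ?invr_ge0 ?sqr_ge0.
  - by move=> x; rewrite sqr_ge0.
  move=> x; have den : (d x + delta) ^- 2 <= delta ^- 2.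
    rewrite lef_pV2 ?posrE ?exprn_gt0 ?ltr_wpDl//.
    by rewrite ler_pXn2r ?nnegrE ?(ltW delta0) ?lerDr// addr_ge0// ltW.
  have den0 : 0 <= (d x + delta) ^- 2 by rewrite invr_ge0 sqr_ge0.
  apply: (le_trans (ler_wpM2r den0 (sqr_split (u x) (phi x) t0))).
  rewrite mulrDl -mulrA lerD2l /K1 -[leRHS]mulrA -mulrA ler_wpM2l//.
  by rewrite mulrC ler_wpM2r// sqr_ge0.
have s2 : (\int[mu]_(x in Omega) (F (gradient phi x) ^+ 2)%:E <=
    (1 + t)%:E * \int[mu]_(x in Omega) (F (Du x) ^+ 2)%:E + (K2 t)%:E * Y)%E.
  apply: dominate => //.
  - by rewrite /K2 mulr_ge0// sqr_ge0.
  - exact: mFcomp.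
  - by move=> x; rewrite sqr_ge0.
  - by move=> x; rewrite sqr_ge0.
  - by move=> x; rewrite sqr_ge0.
  move=> x; apply: (le_trans (sqr_split (F (gradient phi x)) (F (Du x)) t0)).
  rewrite lerD2l /K2 -mulrA ler_wpM2l// -exprMn -ler_sqrt ?sqr_ge0//.
  rewrite !sqrtr_sqr [leRHS]ger0_norm; last by rewrite mulr_ge0 ?sqrtr_ge0// ltW.
  apply: (le_trans (seminorm_sub (finslerD hF) (scn_homogeneous hF) _ _)).
  apply: (le_trans (CP _)); rewrite ler_pM2l// -normrN opprB.
  exact: norm_le_euclidean.
apply: (le_trans s1); rewrite [leRHS]EFinD; apply: leeD; last first.
  rewrite [leRHS]EFinM; apply: lee_wpmul2l => //.
  by rewrite lee_fin /K1 mulr_ge0// invr_ge0 sqr_ge0.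
rewrite [leRHS]EFinM; apply: lee_wpmul2l; first by rewrite lee_fin.
apply: (le_trans (hardy_test tphi delta0)).
rewrite [leRHS]EFinM; apply: lee_wpmul2l; first by rewrite lee_fin.
apply: (le_trans s2); rewrite bE [leRHS]EFinD [((1 + t) * b)%:E]EFinM.
apply: leeD => //.
rewrite [leRHS]EFinM; apply: lee_wpmul2l => //.
by rewrite lee_fin /K2 mulr_ge0// sqr_ge0.
Qed.

(** The weights increase to the inverse square of the distance as the shift
    decreases to 0, so monotone convergence applies. *)
Lemma hardy_H10 :
  ((4^-1)%:E * \int[mu]_(x in Omega) (u x ^+ 2 / d x ^+ 2)%:E
   <= \int[mu]_(x in Omega) (F (Du x) ^+ 2)%:E)%E.
Proof.
rewrite lee_pdivrMl//.
pose f (m : nat) x := (u x ^+ 2 / (d x + m.+1%:R^-1) ^+ 2)%:E.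
have m0 (m : nat) : 0 < m.+1%:R^-1 :> R by rewrite invr_gt0.
have den_gt0 m x : 0 < (d x + m.+1%:R^-1) ^+ 2 by rewrite exprn_gt0// ltr_wpDl.
have mf m : measurable_fun Omega (f m) by apply/measurable_EFinP; exact: mweight.
have f0 m x : Omega x -> (0 <= f m x)%E.
  by move=> _; rewrite lee_fin mulr_ge0 ?sqr_ge0// invr_ge0 ltW.
have fnd x : Omega x -> nondecreasing_seq (f ^~ x).
  move=> _ p q pq; rewrite lee_fin ler_wpM2l ?sqr_ge0//.
  have nn (m : nat) : 0 <= d x + m.+1%:R^-1 by rewrite addr_ge0// ltW.
  rewrite lef_pV2 ?posrE// ler_pXn2r ?nnegrE//.
  by rewrite lerD2l lef_pV2 ?posrE ?ltr0n// ler_nat.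
have flim x : Omega x -> (u x ^+ 2 / d x ^+ 2)%:E = limn (f ^~ x).
  move=> Ox; have d0 := dist_gt0 hF hbd oOmega Ox.
  apply/esym/cvg_lim => //; apply: cvg_EFin; first exact: nearW.
  apply: cvgM; first exact: cvg_cst.
  have c : (fun m : nat => d x + m.+1%:R^-1) @ \oo --> d x.
    rewrite -[X in _ --> X]addr0; apply: cvgD; first exact: cvg_cst.
    exact: cvg_harmonic.
  apply: cvgV; first by rewrite gt_eqF// exprn_gt0.
  by rewrite expr2; under eq_fun do rewrite expr2; exact: cvgM.
rewrite (eq_integral (fun x => limn (f ^~ x))); last first.
  by move=> x /set_mem /flim.
rewrite monotone_convergence//; apply: lime_le.
  apply: ereal_nondecreasing_is_cvgn => p q pq.
  by apply: ge0_le_integral => // [x /f0 //|x /fnd]; exact.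
by apply: nearW => m; exact: hardy_shifted.
Qed.

End hardy.

Unset Implicit Arguments.
Set Strict Implicit.
Set Printing Implicit Defensive.

Theorem theorem3p1 (R : realType) (n : nat) (F : 'rV[R]_n -> R)
    (hF : strongly_convex_norm F)
    (Omega : set 'rV[R]_n) (hOmega : domain Omega)
    (hbd : boundary Omega !=set0)
    (hd : finsler_superharmonic F Omega (dist_boundary F Omega))
    (u : 'rV[R]_n -> R) (Du : 'rV[R]_n -> 'rV[R]_n) (hu : H10 Omega u Du) :
  ((4^-1)%:E * \int[lebesgue_row n]_(x in Omega)
      (u x ^+ 2 / dist_boundary F Omega x ^+ 2)%:E
   <= \int[lebesgue_row n]_(x in Omega) (F (Du x) ^+ 2)%:E)%E.
Proof.
exact: (hardy_H10 hF (proj1 hOmega) hbd hd hu).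
Qed.
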